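(* Let $k=2m>l=2h+1\ge 1$ be integers ($k$ even, $l$ odd) and $N>2k$. Then there exist $k$ positive constants $C_{k,l}^i$ ($i=1,\dots,k$) such that for all $u\in C_c^\infty(\mathbb{H}^N\setminus\{o\})$ $$\int_{\mathbb{H}^N}(\Delta_r^m u)^2\,dv_{\mathbb{H}^N}-\Big(\frac{N-1}{2}\Big)^{4(m-h)-2}\int_{\mathbb{H}^N}|\nabla_r(\Delta_r^h u)|^2\,dv_{\mathbb{H}^N}\ \ge\ \sum_{i=1}^{k}C_{k,l}^i\int_{\mathbb{H}^N}\frac{u^2}{r^{2i}}\,dv_{\mathbb{H}^N},$$ where $$C_{k,l}^1=\begin{cases}\dfrac{(N-1)^{2k-2l-1}}{2^{2k-2l+2}}\,\Xi_{2,(l-1)/2}^{l-1}+C_{k-l-1,0}^{1}\,\Xi_{2,(l+1)/2}^{l+1} & \text{if } m-h\ne 1,\\[2mm] \dfrac{N-1}{16}\,\Xi_{2,(l-1)/2}^{l-1} & \text{if } m-h=1\ (\text{i.e. } k=2h+2,\ l=2h+1),\end{cases}$$ and $$C_{k,l}^k=\begin{cases}C_{k-l-1,0}^{k-l-1}\,\Xi_{2(k-l-1),(l+1)/2}^{0} & \text{if } m-h\ne 1,\\[2mm] \dfrac{(N-4)^2}{16}\,\Xi_{4,(l-1)/2}^{0} & \text{if } m-h=1,\end{cases}$$ with the quantities $C_{n,0}^{n}$, $C_{n,0}^{1}$, $\Xi_{\alpha,\beta}^{0}$, $\Xi_{\alpha,\beta}^{2\beta}$ given by the explicit formulas in the 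context.
   Context: $\mathbb{H}^N$ is the $N$-dimensional hyperbolic space with a fixed pole $o$. In geodesic polar coordinates $x=(r,\sigma)\in(0,\infty)\times\mathbb{S}^{N-1}$ about $o$, with $r$ the geodesic distance from $x$ to $o$, the metric is $dr^2+\sinh^2 r\,d\omega^2$ and $dv_{\mathbb{H}^N}=(\sinh r)^{N-1}\,dr\,d\sigma$ is the volume element. The radial gradient is $\nabla_r u=(\frac{\partial u}{\partial r},0)$, so $|\nabla_r u|^2=(\frac{\partial u}{\partial r})^2$; the radial Laplacian is $\Delta_r u=\frac{\partial^2u}{\partial r^2}+(N-1)\coth r\,\frac{\partial u}{\partial r}$, and $\Delta_r^j$ is its $j$-th iterate ($\Delta_r^0u=u$). The constants depend only on $N,k,l,i$, not on $u$. Explicit quantities (empty sums are $0$, empty products are $1$). For a positive integer $n$: $$C_{n,0}^n=\begin{cases}\big(\frac{N-4}{2^{2p}}\big)^2\prod_{j=1}^{p-1}(N+4j)^2(N-4j-4)^2 & n=2p,\\ \frac{1}{2^{4p+2}}\prod_{j=1}^{p}(N+4j-2)^2(N-4j-2)^2 & n=2p+1,\end{cases}$$ $$C_{n,0}^1=\begin{cases}\frac{N(N-1)}{2^{4p}}\sum_{j=1}^{p}(N-1)^{4p-2j-2} & n=2p,\\ \frac{N(N-1)}{2^{4p+2}}\sum_{j=1}^{p}(N-1)^{2p+2j-2}+\frac{(N-1)^{2p}}{2^{4p+2}} & n=2p+1.\end{cases}$$ For $\alpha\ge0$ and an integer $\beta\ge1$: $$\Xi_{\alpha,\beta}^0=\prod_{j=0}^{\beta-1}\frac{(N+\alpha+4j)^2(N-\alpha-4j-4)^2}{16},\qquad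 \Xi_{\alpha,\beta}^{2\beta}=\Big(\frac{N-1}{4}\Big)^{2\beta},$$ and $\Xi_{\alpha,0}^0=1$. *)

(* Defs.v *)
From HB Require Import structures.
From mathcomp Require Import all_boot all_order all_algebra.
From mathcomp Require Import all_classical all_reals all_analysis.

Set Implicit Arguments.
Unset Strict Implicit.
Unset Printing Implicit Defensive.

Import Order.TTheory GRing.Theory Num.Theory.
Import numFieldNormedType.Exports.

Local Open Scope classical_set_scope.
Local Open Scope ring_scope.

Section hyperbolic_functions.
Context {R : realType}.
Implicit Type x : R.

Definition sinh x : R := (expR x - expR (- x)) / 2.
Definition cosh x : R := (expR x + expR (- x)) / 2.
Definition coth x : R := cosh x / sinh x.

End hyperbolic_functions.

(* The N-dimensional Lebesgue measure and the surface measure of the unit     *)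
(* sphere S^(N-1). Points of R^N are tuples here, since tuples carry the      *)
(* product sigma-algebra in the library.                                      *)
Section sphere_measure.
Context {R : realType}.
Local Notation mR := (measurableTypeR R).

Fixpoint lebesgue_tuple (n : nat) : set (n.-tuple mR) -> \bar R :=
  match n return set (n.-tuple mR) -> \bar R with
  | 0 => \d_ [tuple]
  | n'.+1 => pushforward (lebesgue_measure \x @lebesgue_tuple n')%E
               (fun p : mR * n'.-tuple mR => [tuple of p.1 :: p.2])
  end.

Definition euclidean_norm N (x : N.-tuple mR) : R :=
  Num.sqrt (\sum_(i < N) (tnth x i : R) ^+ 2).

Definition normalize N (x : N.-tuple mR) : N.-tuple mR :=
  [tuple of map (fun t : R => (euclidean_norm x)^-1 * t) x].

Definition sphere N : set (N.-tuple mR) := [set s | euclidean_norm s = 1].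

(* sigma(A) = N |{t s : 0 < t <= 1, s in A}| *)
Definition sphere_measure N (A : set (N.-tuple mR)) : \bar R :=
  (N%:R%:E * lebesgue_tuple
     [set x | (0 < euclidean_norm x <= 1)%R /\ A (normalize x)])%E.

End sphere_measure.

(* H^N is described in geodesic normal coordinates at the pole o, i.e. through *)
(* the diffeomorphism exp_o : R^N -> H^N: the pole is 0, and the point with    *)
(* geodesic polar coordinates (r, s) is r *: s, for 0 < r and s in S^(N-1).    *)
Section hyperbolic_space.
Context {R : realType} (N : nat).
Local Notation mR := (measurableTypeR R).

Fixpoint Ck (k : nat) (f : 'rV[R]_N -> R) : Prop :=
  match k with
  | 0 => continuous f
  | k'.+1 => (forall x, differentiable f x) /\ forall v, Ck k' ('D_v f)
  end.

Definition smooth (f : 'rV[R]_N -> R) : Prop := forall k, Ck k f.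

Definition tsupport (f : 'rV[R]_N -> R) : set 'rV[R]_N :=
  closure [set x | f x != 0].

(* C_c^oo(H^N \ {o}), each function being extended by 0 at o *)
Definition test_function (u : 'rV[R]_N -> R) : Prop :=
  [/\ smooth u, compact (tsupport u) & ~ tsupport u 0].

(* functions of the polar coordinates (r, s); only 0 < r and s in S^(N-1)     *)
(* are meaningful                                                             *)
Definition polar_fun : Type := R -> N.-tuple mR -> R.

Definition polar (u : 'rV[R]_N -> R) : polar_fun :=
  fun r s => u (r *: \row_i (tnth s i : R)).

Definition radial_derive (f : polar_fun) : polar_fun :=
  fun r s => derive1 (fun t => f t s) r.

Definition radial_laplacian (f : polar_fun) : polar_fun := fun r s =>
  radial_derive (radial_derive f) r s
  + (N%:R - 1) * coth r * radial_derive f r s.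

(* integral against dv = (sinh r)^(N-1) dr dsigma *)
Definition hyperbolic_integral (f : polar_fun) : \bar R :=
  (\int[@sphere_measure R N]_(s in @sphere R N)
    \int[lebesgue_measure]_(r in `]0%R, +oo[)
      (f r s * sinh r ^+ N.-1)%:E)%E.

End hyperbolic_space.

Section constants.
Context {R : realType} (N : nat).
Local Notation n := (N%:R : R).

(* C_{q,0}^q *)
Definition C_last (q : nat) : R :=
  let p := q./2 in
  if odd q then
    1 / 2 ^+ (4 * p + 2) *
    \prod_(1 <= j < p.+1)
      ((n + 4 * j%:R - 2) ^+ 2 * (n - 4 * j%:R - 2) ^+ 2)
  else
    ((n - 4) / 2 ^+ (2 * p)) ^+ 2 *
    \prod_(1 <= j < p) ((n + 4 * j%:R) ^+ 2 * (n - 4 * j%:R - 4) ^+ 2).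

(* C_{q,0}^1 *)
Definition C_first (q : nat) : R :=
  let p := q./2 in
  if odd q then
    n * (n - 1) / 2 ^+ (4 * p + 2) *
      (\sum_(1 <= j < p.+1) (n - 1) ^+ (2 * p + 2 * j - 2))
    + (n - 1) ^+ (2 * p) / 2 ^+ (4 * p + 2)
  else
    n * (n - 1) / 2 ^+ (4 * p) *
      \sum_(1 <= j < p.+1) (n - 1) ^+ (4 * p - 2 * j - 2).

(* Xi_{alpha,beta}^0 *)
Definition Xi_first (alpha : R) (beta : nat) : R :=
  \prod_(0 <= j < beta)
    ((n + alpha + 4 * j%:R) ^+ 2 * (n - alpha - 4 * j%:R - 4) ^+ 2 / 16).

(* Xi_{alpha,beta}^{2 beta}, which does not depend on alpha *)
Definition Xi_last (alpha : R) (beta : nat) : R :=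
  ((n - 1) / 4) ^+ (2 * beta).

End constants.

(* Main.v *)
From HB Require Import structures.
Require Import Defs.
From mathcomp Require Import all_boot all_order all_algebra.
From mathcomp Require Import all_classical all_reals all_analysis.
From mathcomp Require Import measurable_realfun measurable_fun_approximation.
From mathcomp Require Import zify ring lra.
Import Order.TTheory GRing.Theory Num.Theory.
Import numFieldNormedType.Exports.
Local Open Scope classical_set_scope.
Local Open Scope ring_scope.

Set Implicit Arguments.
Unset Strict Implicit.
Unset Printing Implicit Defensive.

(** Write [n = N - 1]. On the ray in direction [s] the function [u] becomes a
    smooth [g] with compact support in [(0, +oo)], the radial Laplacian becomes
    [g'' + n coth r g'], and every integral in the theorem is an integral over
    the sphere of some
      [energy i g = int_0^oo g^2 r^(-2 i) sinh^n dr].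
    The constants do not see [s], so it is enough to compare energies on one ray
    and to integrate the result over the sphere.

    On a ray, two inequalities come from completing a square and integrating by
    parts: [weighted_hardy], from [(g' + phi g)^2 >= 0] with
    [phi = (n/2) coth r - (1 + 2 i)/(2 r)], and [weighted_rellich], from
    [(Delta g + phi g')^2 >= 0] with [phi = - (n/2) coth r - (1 + 2 i)/(2 r)].
    The term in [coth] is the optimal choice at infinity and produces the
    spectral constant [lambda = n^2/4]; the term in [1/r] makes the choice
    optimal at the pole and produces the Euclidean Hardy and Rellich constants.
    Both give an explicit combination of [coth^2], [coth / r] and [r^-2], which
    elementary bounds on [coth] turn into [c1 r^-2 + c2]. This yields,
    with [Delta g] the radial Laplacian of [g]:
    - [rellich_step]: [energy i (Delta g)] controls [energy (i + 2) g], with the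
      Euclidean Rellich constant, and also [(n/4)^2 energy i g];
    - [gradient_gap]: [energy 0 (Delta g) - lambda energy 0 g'] controls
      [energy 1 g] and [energy 2 g];
    - [laplacian_gap]: so does [energy 0 (Delta g) - lambda^2 energy 0 g].

    Put [G j = Delta^j g] and [m = h + p + 1]. The left-hand side of the theorem
    telescopes into [lambda^(2 p)] times the gradient gap of [G h] plus
    [lambda^(2 (p - j))] times the Laplacian gap of [G (h + j)] for
    [1 <= j <= p] ([gap_telescope]). This leaves energies of exponents 1 and 2 of
    the [G (h + j)], and iterating [rellich_step] brings them down to [g]:
    exponent 1 produces all odd exponents and exponent 2 all even ones, so every
    exponent up to [2 m] occurs with a positive coefficient. Exponent 1 occurs
    only when the second alternative of [rellich_step] is taken every time, and
    exponent [2 m] only when the first one is, starting from [G (m - 1)]; hence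
    the closed forms [gap_const_first] and [gap_const_last].

    To integrate over the sphere, one needs that the integral of nonnegative
    functions is superadditive ([le_integral_sum]) and that the subtracted
    integral is finite. The latter follows from bounds on all radial derivatives
    of [u] that are uniform in the direction ([uniformly_smooth]) and from the
    finiteness of the surface measure ([sphere_measure_finite_measure]). *)

(** * Pointwise derivatives *)

Section pointwise_derivatives.
Context {R : realType}.
Implicit Types (f g : R -> R) (x : R).

(** These rules are stated for functions written pointwise, so that derivatives
    of explicit expressions are obtained by composing the rules as terms. *)
Lemma has_deriv_add f g x df dg : is_derive x 1 f df -> is_derive x 1 g dg ->
  is_derive x 1 (fun y => f y + g y) (df + dg).
Proof. by move=> ? ?; exact: is_deriveD. Qed.

Lemma has_deriv_sub f g x df dg : is_derive x 1 f df -> is_derive x 1 g dg ->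
  is_derive x 1 (fun y => f y - g y) (df - dg).
Proof. by move=> ? ?; exact: is_deriveB. Qed.

Lemma has_deriv_opp f x df : is_derive x 1 f df ->
  is_derive x 1 (fun y => - f y) (- df).
Proof. by move=> ?; exact: is_deriveN. Qed.

Lemma has_deriv_mul f g x df dg : is_derive x 1 f df -> is_derive x 1 g dg ->
  is_derive x 1 (fun y => f y * g y) (df * g x + f x * dg).
Proof.
move=> ? ?; apply: is_derive_eq; rewrite /GRing.scale/=; ring.
Qed.

Lemma has_deriv_eq f x df df' : is_derive x 1 f df -> df = df' ->
  is_derive x 1 f df'.
Proof. by move=> fd <-. Qed.

Lemma has_deriv_cst (c x : R) : is_derive x 1 (fun=> c) 0.
Proof. exact: is_derive_cst. Qed.

Lemma has_deriv_id x : is_derive x 1 (fun y : R => y) 1.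
Proof. exact: is_derive_id. Qed.

Lemma has_deriv_inv f x df : f x != 0 -> is_derive x 1 f df ->
  is_derive x 1 (fun y => (f y)^-1) (- df / f x ^+ 2).
Proof.
move=> fx0 [fd fE]; have -> : - df / f x ^+ 2 = 'D_1 (fun y => (f y)^-1) x.
  by rewrite deriveV// fE /GRing.scale/= mulNr mulrC mulNr.
exact/derivableP/derivableV.
Qed.

Lemma has_deriv_exp f n x df : is_derive x 1 f df ->
  is_derive x 1 (fun y => f y ^+ n) (n%:R * f x ^+ n.-1 * df).
Proof.
move=> fd; case: n => [|n].
  by rewrite mul0r mul0r; exact: is_derive_cst.
elim: n => [|n ih].
  by rewrite /= expr0 !mul1r; under eq_fun do rewrite expr1.
under eq_fun do rewrite exprS.
apply: (has_deriv_eq (has_deriv_mul fd ih)).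
rewrite /= exprS -[n.+2%:R]natr1; ring.
Qed.

Lemma is_derive_derivable f x df : is_derive x 1 f df -> derivable f x 1.
Proof. by case. Qed.

Lemma is_derive_derive1 f x df : is_derive x 1 f df -> derive1 f x = df.
Proof. by case=> _ <-; rewrite derive1E. Qed.

Lemma derivable_is_derive f x : derivable f x 1 -> is_derive x 1 f (derive1 f x).
Proof. by move=> fd; rewrite derive1E; exact/derivableP. Qed.

Lemma derivable_continuous f x : derivable f x 1 -> {for x, continuous f}.
Proof. by move=> /derivable1_diffP; exact: differentiable_continuous. Qed.

Lemma ge0_of_derive_ge0 (f df : R -> R) : f 0 = 0 ->
  (forall x, is_derive x 1 f (df x)) -> (forall x, 0 <= x -> 0 <= df x) ->
  forall x, 0 <= x -> 0 <= f x.
Proof.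
move=> f0 fE df0 x; rewrite le_eqVlt => /predU1P[<-|x0]; first by rewrite f0.
rewrite -f0; apply: (@ger0_derive1_le_cc R f 0 x) => //.
- move=> y /[!in_itv]/= /andP[y0 _].
  by rewrite (is_derive_derive1 (fE y)) df0// ltW.
- by apply: derivable_within_continuous => y _; exact: is_derive_derivable (fE y).
- by rewrite in_itv/= lexx ltW.
- by rewrite in_itv/= lexx ltW.
- exact: ltW.
Qed.

End pointwise_derivatives.

(** * Bounds on the hyperbolic functions *)

Section hyperbolic_bounds.
Context {R : realType}.
Implicit Types x r : R.

Lemma has_deriv_expRN x : is_derive x 1 (fun y : R => expR (- y)) (- expR (- x)).
Proof.
apply: (has_deriv_eq (is_derive1_comp
  (is_derive_expR (- x)) (has_deriv_opp (has_deriv_id x)))).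
by rewrite /GRing.scale/= mulrN1.
Qed.

Lemma has_deriv_cosh x : is_derive x 1 (@cosh R) (sinh x).
Proof.
apply: (has_deriv_eq (has_deriv_mul
  (has_deriv_add (is_derive_expR x) (has_deriv_expRN x)) (has_deriv_cst 2^-1 x))).
rewrite /sinh; lra.
Qed.

Lemma has_deriv_sinh x : is_derive x 1 (@sinh R) (cosh x).
Proof.
apply: (has_deriv_eq (has_deriv_mul
  (has_deriv_sub (is_derive_expR x) (has_deriv_expRN x)) (has_deriv_cst 2^-1 x))).
rewrite /cosh; lra.
Qed.

Lemma sinh0 : sinh 0 = 0 :> R.
Proof. by rewrite /sinh oppr0 subrr mul0r. Qed.

Lemma cosh0 : cosh 0 = 1 :> R.
Proof. by rewrite /cosh oppr0 expR0; lra. Qed.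

Lemma cosh_gt0 x : 0 < cosh x.
Proof. by rewrite /cosh divr_gt0// addr_gt0// expR_gt0. Qed.

Lemma cosh2_sinh2 x : cosh x ^+ 2 = sinh x ^+ 2 + 1.
Proof.
have := expRxMexpNx_1 x; rewrite /cosh /sinh.
set u := expR x; set v := expR (- x) => uv.
have -> : ((u + v) / 2) ^+ 2 = ((u - v) / 2) ^+ 2 + u * v by field.
by rewrite uv.
Qed.

Lemma sinh_ge0 x : 0 <= x -> 0 <= sinh x.
Proof.
apply: ge0_of_derive_ge0 (sinh0) has_deriv_sinh _ x => x _; exact/ltW/cosh_gt0.
Qed.

Lemma cosh_ge1 x : 0 <= x -> 1 <= cosh x.
Proof.
move=> x0; rewrite -subr_ge0.
apply: (@ge0_of_derive_ge0 _ (fun x => cosh x - 1) (fun x => sinh x - 0)) => //.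
- by rewrite cosh0 subrr.
- by move=> y; exact: (has_deriv_sub (has_deriv_cosh y) (has_deriv_cst 1 y)).
- by move=> y y0; rewrite subr0 sinh_ge0.
Qed.

Lemma sinh_ge x : 0 <= x -> x <= sinh x.
Proof.
move=> x0; rewrite -subr_ge0.
apply: (@ge0_of_derive_ge0 _ (fun x => sinh x - x) (fun x => cosh x - 1)) => //.
- by rewrite sinh0 subrr.
- by move=> y; exact: (has_deriv_sub (has_deriv_sinh y) (has_deriv_id y)).
- by move=> y y0; rewrite subr_ge0 cosh_ge1.
Qed.

Lemma sinh_gt0 x : 0 < x -> 0 < sinh x.
Proof. by move=> x0; exact: lt_le_trans x0 (sinh_ge (ltW x0)). Qed.

Lemma le_sinh_xcosh x : 0 <= x -> sinh x <= x * cosh x.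
Proof.
move=> x0; rewrite -subr_ge0.
apply: (@ge0_of_derive_ge0 _ (fun x => x * cosh x - sinh x)
  (fun x => (1 * cosh x + x * sinh x) - cosh x)) => //.
- by rewrite sinh0 mul0r subrr.
- move=> y.
  exact: (has_deriv_sub (has_deriv_mul (has_deriv_id y) (has_deriv_cosh y))
    (has_deriv_sinh y)).
- by move=> y y0; rewrite mul1r addrAC subrr add0r mulr_ge0 ?sinh_ge0.
Qed.

Lemma xcosh_le x : 0 <= x -> 3 * x * cosh x <= (3 + x ^+ 2) * sinh x.
Proof.
move=> x0; rewrite -subr_ge0.
apply: (@ge0_of_derive_ge0 _ (fun x => (3 + x ^+ 2) * sinh x - 3 * x * cosh x)
  (fun x => x * (x * cosh x - sinh x))) => //.
- by rewrite sinh0 mulr0 mulr0 mul0r subrr.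
- move=> y; apply: (has_deriv_eq (has_deriv_sub
    (has_deriv_mul (has_deriv_add (has_deriv_cst 3 y)
      (has_deriv_exp 2 (has_deriv_id y))) (has_deriv_sinh y))
    (has_deriv_mul (has_deriv_mul (has_deriv_cst 3 y) (has_deriv_id y))
      (has_deriv_cosh y)))).
  by rewrite /= expr1; ring.
- by move=> y y0; rewrite mulr_ge0// subr_ge0 le_sinh_xcosh.
Qed.

(** The difference of the two sides and its first two derivatives vanish at 0,
    and its third derivative is nonnegative by [le_sinh_xcosh]. *)
Lemma sinh2_le x : 0 <= x -> (3 - x ^+ 2) * sinh x ^+ 2 <= 3 * x ^+ 2.
Proof.
pose S (y : R) := sinh y; pose C (y : R) := cosh y.
pose e0 (y : R) := 3 * y ^+ 2 - (3 - y ^+ 2) * S y ^+ 2.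
pose e1 (y : R) := 6 * y + 2 * y * S y ^+ 2 - 2 * (3 - y ^+ 2) * (S y * C y).
pose e2 (y : R) := 8 * y * (S y * C y) + 4 * y ^+ 2 * S y ^+ 2 + 2 * y ^+ 2
   - 10 * S y ^+ 2.
pose e3 (y : R) := 12 * (y * C y - S y) * C y + 8 * y ^+ 2 * (S y * C y)
   + 12 * y * S y ^+ 2.
have dS (y : R) : is_derive y 1 S (C y) := has_deriv_sinh y.
have dC (y : R) : is_derive y 1 C (S y) := has_deriv_cosh y.
have CE (y : R) : C y * C y = S y * S y + 1.
  by have := cosh2_sinh2 y; rewrite !expr2.
have dSC (y : R) : is_derive y 1 (fun y => S y * C y) (1 + 2 * S y ^+ 2).
  apply: (has_deriv_eq (has_deriv_mul (dS y) (dC y))).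
  by rewrite CE; ring.
have dS2 (y : R) : is_derive y 1 (fun y => S y ^+ 2) (2 * (S y * C y)).
  apply: (has_deriv_eq (has_deriv_exp 2 (dS y))).
  by rewrite /= expr1; ring.
have dm (c : R) (y : R) : is_derive y 1 (fun y => c * y) c.
  apply: (has_deriv_eq (has_deriv_mul (has_deriv_cst c y) (has_deriv_id y))).
  by ring.
have dm2 (c : R) (y : R) : is_derive y 1 (fun y => c * y ^+ 2) (2 * c * y).
  apply: (has_deriv_eq (has_deriv_mul (has_deriv_cst c y)
    (has_deriv_exp 2 (has_deriv_id y)))).
  by rewrite /= expr1; ring.
have d3 (y : R) : is_derive y 1 (fun y => 3 - y ^+ 2) (- (2 * y)).
  apply: (has_deriv_eq (has_deriv_sub (has_deriv_cst 3 y)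
    (has_deriv_exp 2 (has_deriv_id y)))).
  by rewrite /= expr1; ring.
move=> x0; rewrite -subr_ge0.
apply: (@ge0_of_derive_ge0 _ e0 e1) => //.
- by rewrite /e0 /S sinh0; ring.
- move=> y; apply: (has_deriv_eq (has_deriv_sub (dm2 3 y)
    (has_deriv_mul (d3 y) (dS2 y)))).
  by rewrite /e1; ring.
apply: (@ge0_of_derive_ge0 _ e1 e2) => //.
- by rewrite /e1 /S sinh0; ring.
- move=> y; apply: (has_deriv_eq (has_deriv_sub
    (has_deriv_add (dm 6 y) (has_deriv_mul (dm 2 y) (dS2 y)))
    (has_deriv_mul (has_deriv_mul (has_deriv_cst 2 y) (d3 y)) (dSC y)))).
  by rewrite /e2; ring.
apply: (@ge0_of_derive_ge0 _ e2 e3) => //.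
- by rewrite /e2 /S sinh0; ring.
- move=> y; apply: (has_deriv_eq (has_deriv_sub (has_deriv_add (has_deriv_add
    (has_deriv_mul (dm 8 y) (dSC y)) (has_deriv_mul (dm2 4 y) (dS2 y))) (dm2 2 y))
    (has_deriv_mul (has_deriv_cst 10 y) (dS2 y)))).
  have -> : e3 y = 12 * y * (C y * C y) - 12 * (S y * C y)
    + 8 * y ^+ 2 * (S y * C y) + 12 * y * S y ^+ 2 by rewrite /e3; ring.
  by rewrite CE; ring.
move=> y y0; have Sy := sinh_ge0 y0; have Cy := ltW (cosh_gt0 y).
have := le_sinh_xcosh y0; rewrite -subr_ge0 => SC.
by rewrite /e3; do ![exact: SC | exact: Sy | exact: Cy | apply: addr_ge0
  | apply: mulr_ge0 | apply: exprn_ge0 | exact: ler0n | exact: y0].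
Qed.

Lemma coth_ge r : 0 < r -> r^-1 <= coth r.
Proof.
move=> r0; have S0 := sinh_gt0 r0; rewrite /coth ler_pdivlMr//.
by rewrite mulrC ler_pdivrMr// mulrC le_sinh_xcosh// ltW.
Qed.

Lemma coth_le r : 0 < r -> coth r * r^-1 <= r^-1 ^+ 2 + 3^-1.
Proof.
move=> r0; have S0 := sinh_gt0 r0.
have -> : r^-1 ^+ 2 + 3^-1 = ((3 + r ^+ 2) / (3 * r)) / r.
  by field; rewrite gt_eqF.
apply: ler_wpM2r; first by rewrite invr_ge0 ltW.
rewrite /coth ler_pdivrMr// mulrAC.
rewrite ler_pdivlMr ?mulr_gt0// mulrC.
exact/xcosh_le/ltW.
Qed.

Lemma coth2E r : 0 < r -> coth r ^+ 2 = 1 + (sinh r ^+ 2)^-1.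
Proof.
move=> r0; rewrite /coth expr_div_n cosh2_sinh2; field.
by rewrite gt_eqF// sinh_gt0.
Qed.

Lemma coth2_ge1 r : 0 < r -> 1 <= coth r ^+ 2.
Proof. by move=> r0; rewrite coth2E// lerDl invr_ge0 sqr_ge0. Qed.

Lemma coth2_ge r : 0 < r -> r^-1 ^+ 2 + 2 / 3 <= coth r ^+ 2.
Proof.
move=> r0; have S0 := sinh_gt0 r0.
rewrite coth2E//.
suff : r^-1 ^+ 2 - 3^-1 <= (sinh r ^+ 2)^-1 by lra.
have -> : r^-1 ^+ 2 - 3^-1 = (3 - r ^+ 2) / (3 * r ^+ 2).
  by field; rewrite gt_eqF.
rewrite ler_pdivrMr ?mulr_gt0 ?exprn_gt0// mulrC ler_pdivlMr ?exprn_gt0//.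
exact/sinh2_le/ltW.
Qed.

Lemma has_deriv_coth r : 0 < r -> is_derive r 1 (@coth R) (1 - coth r ^+ 2).
Proof.
move=> r0; have S0 : sinh r != 0 by rewrite gt_eqF// sinh_gt0.
apply: (has_deriv_eq (has_deriv_mul (has_deriv_cosh r)
  (has_deriv_inv S0 (has_deriv_sinh r)))).
by rewrite /coth; field.
Qed.

End hyperbolic_bounds.

(** * Integration on the half-line *)

Section half_line.
Context {R : realType} (a b : R).
Implicit Types (f g q F : R -> R) (r : R).

Definition supported q := forall r, 0 < r -> r < a \/ b < r -> q r = 0.

Definition compact_continuous q :=
  (forall r, 0 < r -> {for r, continuous q}) /\ supported q.

Definition half_line_integral q : R :=
  \int[@lebesgue_measure R]_(r in `]0%R, +oo[) q r.

Hypotheses (a0 : 0 < a) (ab : a <= b).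

Let support_bounds r : 0 < r -> r \notin `[a, b] -> r < a \/ b < r.
Proof.
move=> r0; rewrite in_itv/= negb_and -!ltNge => /orP[?|?]; [by left|by right].
Qed.

(** The interval is larger than [[a, b]] so that a function supported in
    [[a, b]] vanishes at its end points. *)
Lemma integral_half_line_supported q : supported q ->
  (\int[lebesgue_measure]_(r in `]0%R, +oo[) (q r)%:E =
   \int[lebesgue_measure]_(r in `[(a / 2)%R, (b + 1)%R]) (q r)%:E)%E.
Proof.
move=> sq.
have -> : `[a / 2, b + 1]%classic = `]0, +oo[ `&` `[a / 2, b + 1] :> set R.
  apply/seteqP; split=> x /=; rewrite !in_itv/=; last by case.
  by move=> /andP[ax xb]; rewrite ax xb andbT; split=> //; move: a0; lra.
rewrite integral_mkcondr; apply: eq_integral => x.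
rewrite inE/= in_itv/= andbT => x0; rewrite patchE; case: ifPn => //.
rewrite notin_setE/= in_itv/= => /negP; rewrite negb_and -!ltNge => xab.
by rewrite sq//; case/orP: xab => ?; [left|right]; move: a0 ab; lra.
Qed.

Lemma compact_continuous_integrable q : compact_continuous q ->
  (@lebesgue_measure R).-integrable `]0%R, +oo[ (EFin \o q).
Proof.
move=> [cq sq]; have iq : (@lebesgue_measure R).-integrable `[a, b] (EFin \o q).
  apply: continuous_compact_integrable; first exact: segment_compact.
  apply: continuous_in_subspaceT => x; rewrite inE/= in_itv/= => /andP[ax _].
  exact/cq/(lt_le_trans a0).
have E : `[a, b]%classic = `]0, +oo[ `&` `[a, b] :> set R.
  apply/seteqP; split=> x /=; rewrite !in_itv/=; last by case.
  by move=> /andP[ax xb]; rewrite ax xb andbT; split=> //; exact: lt_le_trans ax.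
rewrite E in iq; move: iq => /integrable_restrict iq.
have := iq (measurable_itv _) (measurable_itv _).
apply: eq_integrable => [|x]; first exact: measurable_itv.
rewrite inE/= in_itv/= andbT => x0; rewrite patchE; case: ifPn => //.
by rewrite notin_setE/= => /negP/(support_bounds x0) xab; rewrite sq.
Qed.

Lemma half_line_integralE q : compact_continuous q ->
  (\int[lebesgue_measure]_(r in `]0%R, +oo[) (q r)%:E)%E =
  (half_line_integral q)%:E.
Proof.
move=> cq; rewrite /half_line_integral /Rintegral fineK//.
by apply: integrable_fin_num => //; exact: compact_continuous_integrable.
Qed.

Lemma compact_continuousD f g : compact_continuous f -> compact_continuous g ->
  compact_continuous (fun r => f r + g r).
Proof.
move=> [cf sf] [cg sg]; split=> [r r0|r r0 rab]; last by rewrite sf// sg// addr0.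
by apply: continuousD; [exact: cf|exact: cg].
Qed.

Lemma compact_continuousM f g : (forall r, 0 < r -> {for r, continuous f}) ->
  compact_continuous g -> compact_continuous (fun r => f r * g r).
Proof.
move=> cf [cg sg]; split=> [r r0|r r0 rab]; last by rewrite sg// mulr0.
by apply: continuousM; [exact: cf|exact: cg].
Qed.

Lemma compact_continuousZ (c : R) g :
  compact_continuous g -> compact_continuous (fun r => c * g r).
Proof. by apply: compact_continuousM => r _; exact: cst_continuous. Qed.

Lemma half_line_integralD f g : compact_continuous f -> compact_continuous g ->
  half_line_integral (fun r => f r + g r) =
  half_line_integral f + half_line_integral g.
Proof.
by move=> cf cg; apply: RintegralD => //; exact: compact_continuous_integrable.
Qed.

Lemma half_line_integralZ (c : R) g : compact_continuous g ->
  half_line_integral (fun r => c * g r) = c * half_line_integral g.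
Proof.
by move=> cg; apply: RintegralZl => //; exact: compact_continuous_integrable.
Qed.

Lemma half_line_integral_ge0 q : (forall r, 0 < r -> 0 <= q r) ->
  0 <= half_line_integral q.
Proof.
move=> q0; apply: Rintegral_ge0 => r /=; rewrite in_itv/= andbT; exact: q0.
Qed.

Lemma supported_derive F : supported F -> supported (derive1 F).
Proof.
move=> sF r r0 rab; rewrite derive1E (@near_eq_derive _ _ _ F (cst 0)).
  by rewrite derive_cst.
case: rab => [ra|br].
- near=> x; rewrite /= sF//; first by near: x; exact: lt_nbhsr.
  by left; near: x; exact: lt_nbhsl.
- near=> x; rewrite /= sF//; first by near: x; exact: lt_nbhsr.
  by right; near: x; exact: lt_nbhsr.
Unshelve. all: by end_near. Qed.

Lemma half_line_integral_derive F (dF : R -> R) : supported F ->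
  (forall r, 0 < r -> is_derive r 1 F (dF r)) ->
  (forall r, 0 < r -> {for r, continuous dF}) ->
  compact_continuous dF /\ half_line_integral dF = 0.
Proof.
move=> sF FE cdF; have dFE r : 0 < r -> derive1 F r = dF r.
  by move=> r0; rewrite (is_derive_derive1 (FE _ r0)).
have sdF : supported dF.
  by move=> r r0 rab; rewrite -dFE// supported_derive.
split=> //; rewrite /half_line_integral /Rintegral.
rewrite integral_half_line_supported//.
have F0 x : 0 < x -> {for x, continuous F}.
  by move=> x0; exact/derivable_continuous/(is_derive_derivable (FE _ x0)).
have a20 : 0 < a / 2 by rewrite divr_gt0.
rewrite (@continuous_FTC2 _ dF F).
- have -> : F (b + 1) = 0 by apply: sF; [move: a0 ab|right]; lra.
  have -> : F (a / 2) = 0 by apply: sF; [|left; move: a0]; lra.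
  by rewrite subee.
- by move: ab; lra.
- apply: continuous_in_subspaceT => x; rewrite inE/= in_itv/= => /andP[ax _].
  by apply: cdF; lra.
- split.
  + move=> x; rewrite in_itv/= => /andP[ax _].
    by apply: is_derive_derivable (FE _ _); lra.
  + by apply: cvg_at_right_filter; exact: F0.
  + by apply: cvg_at_left_filter; apply: F0; move: ab; lra.
- by move=> x; rewrite in_itv/= => /andP[ax _]; apply: dFE; lra.
Qed.

(** Integration by parts in the form in which it is used below: integrands are
    compared modulo the derivative of a compactly supported function. *)
Lemma le_half_line_integral q1 q2 F (dF : R -> R) :
  compact_continuous q1 -> compact_continuous q2 -> supported F ->
  (forall r, 0 < r -> is_derive r 1 F (dF r)) ->
  (forall r, 0 < r -> {for r, continuous dF}) ->
  (forall r, 0 < r -> q2 r <= q1 r + dF r) ->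
  half_line_integral q2 <= half_line_integral q1.
Proof.
move=> c1 c2 sF FE cdF le21.
have [cc dF0] := half_line_integral_derive sF FE cdF.
rewrite -[leRHS]addr0 -dF0 -half_line_integralD//.
apply: le_Rintegral => //.
- exact: compact_continuous_integrable.
- exact/compact_continuous_integrable/compact_continuousD.
- by move=> r /=; rewrite in_itv/= andbT; exact: le21.
Qed.

End half_line.

(** * Weighted Hardy and Rellich inequalities on a ray *)

Section weighted_inequalities.
Context {R : realType} (n : nat) (a b : R).
Hypotheses (a0 : 0 < a) (ab : a <= b).
Implicit Types (f g : R -> R) (r : R) (i : nat).
Local Notation supported := (@supported R a b).
Local Notation compact_continuous := (@compact_continuous R a b).

Definition pos_continuous f := forall r, 0 < r -> {for r, continuous f}.

Lemma pos_continuousD f g : pos_continuous f -> pos_continuous g ->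
  pos_continuous (fun r => f r + g r).
Proof. by move=> cf cg r r0; apply: continuousD; [exact: cf|exact: cg]. Qed.

Lemma pos_continuousM f g : pos_continuous f -> pos_continuous g ->
  pos_continuous (fun r => f r * g r).
Proof. by move=> cf cg r r0; apply: continuousM; [exact: cf|exact: cg]. Qed.

Lemma pos_continuous_cst (c : R) : pos_continuous (fun=> c).
Proof. by move=> r _; exact: cst_continuous. Qed.

Lemma pos_continuousX f k : pos_continuous f -> pos_continuous (fun r => f r ^+ k).
Proof.
move=> cf; elim: k => [|k ih]; first exact: pos_continuous_cst.
by under eq_fun do rewrite exprS; exact: pos_continuousM.
Qed.

Lemma pos_continuousN f : pos_continuous f -> pos_continuous (fun r => - f r).
Proof. by move=> cf r r0; apply: continuousN; exact: cf. Qed.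

Lemma pos_derivable_continuous f :
  (forall r, 0 < r -> derivable f r 1) -> pos_continuous f.
Proof. by move=> df r r0; exact/derivable_continuous/df. Qed.

Definition weight i r : R := sinh r ^+ n / r ^+ (2 * i).

Definition energy i g : R :=
  half_line_integral (fun r => g r ^+ 2 / r ^+ (2 * i) * sinh r ^+ n).

Definition laplacian g r : R := derive1 (derive1 g) r + n%:R * coth r * derive1 g r.

Lemma weight_gt0 i r : 0 < r -> 0 < weight i r.
Proof. by move=> r0; rewrite divr_gt0 ?exprn_gt0 ?sinh_gt0. Qed.

Lemma weightS i r : weight i.+1 r = weight i r * r^-1 ^+ 2.
Proof. by rewrite /weight mulnS exprD invfM exprVn; ring. Qed.

Lemma has_deriv_weight i r : 0 < r -> is_derive r 1 (weight i)
  (weight i r * (n%:R * coth r - 2 * i%:R * r^-1)).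
Proof.
move=> r0; have S0 : sinh r != 0 by rewrite gt_eqF// sinh_gt0.
have rn0 : r != 0 by rewrite gt_eqF.
have r2i0 : r ^+ (2 * i) != 0 by rewrite expf_neq0.
have pow (x : R) k : x != 0 -> k%:R * x ^+ k.-1 = k%:R * x ^+ k / x.
  by case: k => [|k] x0; rewrite ?mul0r// exprS /=; field.
apply: (has_deriv_eq (has_deriv_mul (has_deriv_exp n (has_deriv_sinh r))
  (@has_deriv_inv _ (fun x => x ^+ (2 * i)) r _ r2i0
    (has_deriv_exp (2 * i) (has_deriv_id r))))).
rewrite (pow (sinh r) n S0) (pow r (2 * i)%N rn0) /weight /coth natrM.
set x := sinh r ^+ n; set y := r ^+ (2 * i).
by field; rewrite r2i0 rn0 S0.
Qed.

(** Both inequalities are proved with a flux [phi f^2 w], where [w] is the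
    weight and [phi] is a combination [c coth r + d / r]. *)
Lemma has_deriv_profile (c d : R) r : 0 < r ->
  is_derive r 1 (fun r => c * coth r + d * r^-1)
    (c * (1 - coth r ^+ 2) - d * r^-1 ^+ 2).
Proof.
move=> r0; have rn0 : r != 0 by rewrite gt_eqF.
apply: (has_deriv_eq (has_deriv_add
  (has_deriv_mul (has_deriv_cst c r) (has_deriv_coth r0))
  (has_deriv_mul (has_deriv_cst d r)
    (@has_deriv_inv _ (fun x => x) r _ rn0 (has_deriv_id r))))).
by field.
Qed.

Lemma pos_continuous_weight i : pos_continuous (weight i).
Proof.
by apply: pos_derivable_continuous => r r0;
   exact: is_derive_derivable (has_deriv_weight _ r0).
Qed.

Lemma pos_continuous_coth : pos_continuous (@coth R).
Proof.
by apply: pos_derivable_continuous => r r0;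
   exact: is_derive_derivable (has_deriv_coth r0).
Qed.

Lemma pos_continuousV : pos_continuous (fun r => r^-1).
Proof.
apply: pos_derivable_continuous => r r0; apply: derivableV.
  by rewrite gt_eqF.
exact: derivable_id.
Qed.

Lemma compact_continuous_energy i g :
  (forall r, 0 < r -> derivable g r 1) -> supported g ->
  compact_continuous (fun r => g r ^+ 2 / r ^+ (2 * i) * sinh r ^+ n).
Proof.
move=> dg sg; split=> [|r r0 rab]; last by rewrite sg// expr0n !mul0r.
have := pos_continuousM (pos_continuousX (k := 2) (pos_derivable_continuous dg))
  (@pos_continuous_weight i).
congr pos_continuous; apply/funext => r; rewrite /weight; ring.
Qed.

Lemma energy_ge0 i g : 0 <= energy i g.
Proof.
apply: half_line_integral_ge0 => r r0.
by rewrite mulr_ge0 ?divr_ge0 ?sqr_ge0 ?exprn_ge0 ?sinh_ge0 ?ltW.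
Qed.

(** The common frame of the two inequalities below, where [h] is [f'] or
    [f' + n coth r f], and [F] is the flux. *)
Lemma le_energy i (c1 c2 : R) f (h F dF : R -> R) :
  (forall r, 0 < r -> derivable f r 1) -> supported f ->
  (forall r, 0 < r -> derivable h r 1) -> supported h ->
  supported F -> (forall r, 0 < r -> is_derive r 1 F (dF r)) ->
  pos_continuous dF ->
  (forall r, 0 < r -> weight i r * ((c1 * r^-1 ^+ 2 + c2) * f r ^+ 2)
     <= weight i r * h r ^+ 2 + dF r) ->
  c1 * energy i.+1 f + c2 * energy i f <= energy i h.
Proof.
move=> df sf dh sh sF FE cdF le.
rewrite -!(@half_line_integralZ _ a b a0); try exact: compact_continuous_energy.
rewrite -(@half_line_integralD _ a b a0);
  try exact/compact_continuousZ/compact_continuous_energy.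
apply: (le_half_line_integral a0 ab _ _ sF FE cdF).
- exact: compact_continuous_energy.
- by apply: compact_continuousD; exact/compact_continuousZ/compact_continuous_energy.
move=> r r0; have eE j (q : R -> R) :
    q r ^+ 2 / r ^+ (2 * j) * sinh r ^+ n = weight j r * q r ^+ 2.
  by rewrite /weight; ring.
have := le r r0; rewrite !eE weightS => le1; apply: le_trans le1.
by rewrite le_eqVlt; apply/orP; left; apply/eqP; ring.
Qed.

Definition flux_deriv i (phi dphi : R -> R) f r : R := weight i r *
  ((dphi r + phi r * (n%:R * coth r - 2 * i%:R * r^-1)) * f r ^+ 2
     + 2 * phi r * f r * derive1 f r).

Lemma has_deriv_flux i (phi dphi : R -> R) f r : 0 < r ->
  is_derive r 1 phi (dphi r) -> derivable f r 1 ->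
  is_derive r 1 (fun r => phi r * f r ^+ 2 * weight i r)
    (flux_deriv i phi dphi f r).
Proof.
move=> r0 dphiE df; apply: (has_deriv_eq (has_deriv_mul (has_deriv_mul dphiE
  (has_deriv_exp 2 (derivable_is_derive df))) (has_deriv_weight i r0))).
by rewrite /flux_deriv /= expr1; ring.
Qed.

Lemma pos_continuous_flux i (phi dphi : R -> R) f :
  pos_continuous phi -> pos_continuous dphi ->
  (forall r, 0 < r -> derivable f r 1) ->
  (forall r, 0 < r -> derivable (derive1 f) r 1) ->
  pos_continuous (flux_deriv i phi dphi f).
Proof.
move=> cphi cdphi /pos_derivable_continuous cf /pos_derivable_continuous cdf.
have clog : pos_continuous (fun r => n%:R * coth r - 2 * i%:R * r^-1).
  exact: (pos_continuousD (pos_continuousM (@pos_continuous_cst n%:R)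
    pos_continuous_coth) (pos_continuousN (pos_continuousM
    (@pos_continuous_cst (2 * i%:R)) pos_continuousV))).
have c2 := @pos_continuous_cst 2.
exact: (pos_continuousM (@pos_continuous_weight i) (pos_continuousD
  (pos_continuousM (pos_continuousD cdphi (pos_continuousM cphi clog))
    (pos_continuousX (k := 2) cf))
  (pos_continuousM (pos_continuousM (pos_continuousM c2 cphi) cf) cdf))).
Qed.

Lemma pos_continuous_profile (c d : R) :
  pos_continuous (fun r => c * coth r + d * r^-1) /\
  pos_continuous (fun r => c * (1 - coth r ^+ 2) - d * r^-1 ^+ 2).
Proof.
have cC := @pos_continuous_cst; have cX := pos_continuousX (k := 2).
split.
  exact: (pos_continuousD (pos_continuousM (cC c) pos_continuous_coth)
    (pos_continuousM (cC d) pos_continuousV)).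
exact: (pos_continuousD (pos_continuousM (cC c) (pos_continuousD (cC 1)
  (pos_continuousN (cX _ pos_continuous_coth))))
  (pos_continuousN (pos_continuousM (cC d) (cX _ pos_continuousV)))).
Qed.

Variable i : nat.
Let ir : R := i%:R.
Let nn : R := n%:R.

(** For [phi = (n/2) coth r - (1 + 2 i)/(2 r)], the sum of [g'^2 w] and of the
    derivative of [phi g^2 w] is [(g' + phi g)^2 w] plus [g^2 w] times the
    right-hand side of the first hypothesis. *)
Lemma weighted_hardy (c1 c2 : R) g :
  (forall r, 0 < r -> c1 * r^-1 ^+ 2 + c2 <=
     nn ^+ 2 / 4 * coth r ^+ 2 - nn / 2 * (coth r ^+ 2 - 1)
     - ir * nn * (coth r * r^-1) + (1 + 2 * ir) ^+ 2 / 4 * r^-1 ^+ 2) ->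
  (forall r, 0 < r -> derivable g r 1) ->
  (forall r, 0 < r -> derivable (derive1 g) r 1) -> supported g ->
  c1 * energy i.+1 g + c2 * energy i g <= energy i (derive1 g).
Proof.
move=> c12 dg ddg sg.
pose c : R := nn / 2; pose d : R := - ((1 + 2 * ir) / 2).
pose phi r := c * coth r + d * r^-1.
pose dphi r := c * (1 - coth r ^+ 2) - d * r^-1 ^+ 2.
have [cphi cdphi] := pos_continuous_profile c d.
apply: (@le_energy i c1 c2 g (derive1 g) (fun r => phi r * g r ^+ 2 * weight i r)
  (flux_deriv i phi dphi g) dg sg ddg (supported_derive sg)).
- by move=> r r0 rab; rewrite sg// expr0n mulr0 mul0r.
- move=> r r0.
  exact: (@has_deriv_flux i phi dphi g r r0 (has_deriv_profile c d r0) (dg r r0)).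
- exact: (@pos_continuous_flux i phi dphi g cphi cdphi dg ddg).
move=> r r0; have w0 := weight_gt0 i r0; have := c12 r r0.
rewrite /flux_deriv /dphi /phi -subr_ge0.
set w := weight i r; set y := coth r; set z := r^-1.
set u := g r; set v := derive1 g r.
set D := (X in 0 <= X) => D0; rewrite -subr_ge0.
have -> : w * v ^+ 2 + w * ((c * (1 - y ^+ 2) - d * z ^+ 2 +
    (c * y + d * z) * (n%:R * y - 2 * i%:R * z)) * u ^+ 2 +
    2 * (c * y + d * z) * u * v) - w * ((c1 * z ^+ 2 + c2) * u ^+ 2) =
    w * ((v + (c * y + d * z) * u) ^+ 2 + D * u ^+ 2).
  by rewrite /D /c /d /nn /ir; field.
exact: mulr_ge0 (ltW w0) (addr_ge0 (sqr_ge0 _) (mulr_ge0 D0 (sqr_ge0 _))).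
Qed.

(** Same computation with [(Delta g + phi g')^2 w] and
    [phi = - (n/2) coth r - (1 + 2 i)/(2 r)]: for [v = g'] the Laplacian is the
    first order expression [v' + n coth r v], whose zeroth order term reverses
    the signs of the terms linear in [n] with respect to [weighted_hardy]. *)
Lemma weighted_rellich (c1 c2 : R) g :
  (forall r, 0 < r -> c1 * r^-1 ^+ 2 + c2 <=
     nn ^+ 2 / 4 * coth r ^+ 2 + nn / 2 * (coth r ^+ 2 - 1)
     + ir * nn * (coth r * r^-1) + (1 + 2 * ir) ^+ 2 / 4 * r^-1 ^+ 2) ->
  (forall r, 0 < r -> derivable (derive1 g) r 1) ->
  (forall r, 0 < r -> derivable (derive1 (derive1 g)) r 1) -> supported g ->
  c1 * energy i.+1 (derive1 g) + c2 * energy i (derive1 g)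
    <= energy i (laplacian g).
Proof.
move=> c12 dg ddg sg.
have dlap r : 0 < r -> derivable (laplacian g) r 1.
  move=> r0; apply: is_derive_derivable (has_deriv_add
    (derivable_is_derive (ddg r r0)) (has_deriv_mul (has_deriv_mul
    (has_deriv_cst n%:R r) (has_deriv_coth r0)) (derivable_is_derive (dg r r0)))).
have slap : supported (laplacian g).
  move=> r r0 rab; rewrite /laplacian.
  by rewrite !(supported_derive _ r0 rab) ?mulr0 ?addr0//; exact: supported_derive.
pose c : R := - (nn / 2); pose d : R := - ((1 + 2 * ir) / 2).
pose phi r := c * coth r + d * r^-1.
pose dphi r := c * (1 - coth r ^+ 2) - d * r^-1 ^+ 2.
have [cphi cdphi] := pos_continuous_profile c d.
apply: (@le_energy i c1 c2 (derive1 g) (laplacian g)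
  (fun r => phi r * derive1 g r ^+ 2 * weight i r)
  (flux_deriv i phi dphi (derive1 g)) dg (supported_derive sg) dlap slap).
- by move=> r r0 rab; rewrite (supported_derive sg r0 rab) expr0n mulr0 mul0r.
- move=> r r0.
  exact: (@has_deriv_flux i phi dphi (derive1 g) r r0
    (has_deriv_profile c d r0) (dg r r0)).
- exact: (@pos_continuous_flux i phi dphi (derive1 g) cphi cdphi dg ddg).
move=> r r0; have w0 := weight_gt0 i r0; have := c12 r r0.
rewrite /flux_deriv /dphi /phi -subr_ge0 /laplacian.
set w := weight i r; set y := coth r; set z := r^-1.
set v := derive1 g r; set v' := derive1 (derive1 g) r.
set D := (X in 0 <= X) => D0; rewrite -subr_ge0.
have -> : w * (v' + n%:R * y * v) ^+ 2 + w * ((c * (1 - y ^+ 2) - d * z ^+ 2 +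
    (c * y + d * z) * (n%:R * y - 2 * i%:R * z)) * v ^+ 2 +
    2 * (c * y + d * z) * v * v') - w * ((c1 * z ^+ 2 + c2) * v ^+ 2) =
    w * ((v' + n%:R * y * v + (c * y + d * z) * v) ^+ 2 + D * v ^+ 2).
  by rewrite /D /c /d /nn /ir; field.
exact: mulr_ge0 (ltW w0) (addr_ge0 (sqr_ge0 _) (mulr_ge0 D0 (sqr_ge0 _))).
Qed.

End weighted_inequalities.

(** * Explicit constants for one Laplacian *)

Section radial_inequalities.
Context {R : realType} (n : nat) (a b : R).
Hypotheses (a0 : 0 < a) (ab : a <= b) (n4 : (4 <= n)%N).
Implicit Types (g : R -> R) (r : R) (i : nat).
Local Notation nn := (n%:R : R).
Local Notation E := (energy n).

Definition regular g := [/\ forall r, 0 < r -> derivable g r 1,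
  forall r, 0 < r -> derivable (derive1 g) r 1,
  forall r, 0 < r -> derivable (derive1 (derive1 g)) r 1 & supported a b g].

Let nn_ge4 : 4 <= nn. Proof. by rewrite (ler_nat _ 4). Qed.

Let coth_facts r : 0 < r -> [/\ 0 <= r^-1 ^+ 2, r^-1 ^+ 2 <= coth r * r^-1,
  coth r * r^-1 <= r^-1 ^+ 2 + 3^-1, r^-1 ^+ 2 + 2 / 3 <= coth r ^+ 2 &
  1 <= coth r ^+ 2].
Proof.
move=> r0; split; [exact: sqr_ge0| |exact: coth_le|exact: coth2_ge|exact: coth2_ge1].
by rewrite expr2; apply: ler_wpM2r; [rewrite invr_ge0 ltW|exact: coth_ge].
Qed.

(** The bounds [coth_le] and [coth2_ge] are sharp at the pole, hence so is the
    constant in front of [energy i.+1 g]. *)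
Lemma hardy_power i g : regular g ->
  (nn - 1 - 2 * i%:R) ^+ 2 / 4 * E i.+1 g + nn * (nn + 1 - 2 * i%:R) / 6 * E i g
    <= E i (derive1 g).
Proof.
move=> [dg ddg _ sg]; apply: (weighted_hardy a0 ab _ dg ddg sg) => r /coth_facts[].
have nn4 := nn_ge4.
set z2 := r^-1 ^+ 2; set yz := coth r * r^-1; set y2 := coth r ^+ 2.
move=> _ _ yzle y2ge _; have i0 : 0 <= i%:R :> R by [].
have H1 : 0 <= nn * (nn - 2) * (y2 - (z2 + 2 / 3)).
  by apply: mulr_ge0; [apply: mulr_ge0; lra|lra].
have H2 : 0 <= i%:R * nn * (z2 + 3^-1 - yz).
  by apply: mulr_ge0; [apply: mulr_ge0; lra|lra].
lra.
Qed.

(** Here it is the constant in front of [energy 0 g] that is kept sharp, as it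
    has to produce the power of [n^2/4] that is subtracted in the end. *)
Lemma hardy_poincare g : regular g ->
  1 / 4 * E 1 g + nn ^+ 2 / 4 * E 0 g <= E 0 (derive1 g).
Proof.
move=> [dg ddg _ sg]; apply: (weighted_hardy a0 ab _ dg ddg sg) => r /coth_facts[].
have nn4 := nn_ge4.
set z2 := r^-1 ^+ 2; set yz := coth r * r^-1; set y2 := coth r ^+ 2.
move=> z20 yzge yzle y2ge y2ge1.
have H1 : 0 <= nn * (nn - 2) * (y2 - 1).
  by apply: mulr_ge0; [apply: mulr_ge0; lra|lra].
lra.
Qed.

Lemma rellich_power i g : regular g ->
  (nn + 1 + 2 * i%:R) ^+ 2 / 4 * E i.+1 (derive1 g)
    + nn * (nn - 1) / 6 * E i (derive1 g) <= E i (laplacian n g).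
Proof.
move=> [dg ddg dddg sg].
apply: (weighted_rellich a0 ab _ ddg dddg sg) => r /coth_facts[].
have nn4 := nn_ge4.
set z2 := r^-1 ^+ 2; set yz := coth r * r^-1; set y2 := coth r ^+ 2.
move=> _ yzge _ y2ge _; have i0 : 0 <= i%:R :> R by [].
have H1 : 0 <= nn * (nn + 2) * (y2 - (z2 + 2 / 3)).
  by apply: mulr_ge0; [apply: mulr_ge0; lra|lra].
have H2 : 0 <= i%:R * nn * (yz - z2).
  by apply: mulr_ge0; [apply: mulr_ge0; lra|lra].
lra.
Qed.

Lemma rellich_poincare g : regular g ->
  1 / 4 * E 1 (derive1 g) + nn ^+ 2 / 4 * E 0 (derive1 g) <= E 0 (laplacian n g).
Proof.
move=> [dg ddg dddg sg].
apply: (weighted_rellich a0 ab _ ddg dddg sg) => r /coth_facts[].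
have nn4 := nn_ge4.
set z2 := r^-1 ^+ 2; set yz := coth r * r^-1; set y2 := coth r ^+ 2.
move=> _ yzge _ y2ge y2ge1.
have H1 : 0 <= nn * (nn + 2) * (y2 - 1).
  by apply: mulr_ge0; [apply: mulr_ge0; lra|lra].
lra.
Qed.

(** The two terms of [rellich_power] are used separately: the sharp one with the
    sharp Hardy inequality of the next exponent, the other one with the constant
    term of the Hardy inequality of the same exponent. *)
Lemma rellich_step i g : regular g -> (2 * i + 4 <= n)%N ->
  (nn + 1 + 2 * i%:R) ^+ 2 * (nn - 3 - 2 * i%:R) ^+ 2 / 16 * E i.+2 g
    + (nn / 4) ^+ 2 * E i g <= E i (laplacian n g).
Proof.
have nn4 := nn_ge4; move=> rg; rewrite -(ler_nat R) natrD natrM => hi.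
have i0 : 0 <= i%:R :> R by [].
apply: le_trans (rellich_power i rg).
have := hardy_power i rg; have := hardy_power i.+1 rg.
rewrite -(natr1 i).
have := @energy_ge0 R n i.+2 g; have := @energy_ge0 R n i.+1 g.
have := @energy_ge0 R n i g.
set e0 := E i g; set e1 := E i.+1 g; set e2 := E i.+2 g.
set d0 := E i (derive1 g); set d1 := E i.+1 (derive1 g).
set x : R := i%:R in hi i0 *; move=> e00 e10 e20 h1 h0.
have le1 : (nn - 3 - 2 * x) ^+ 2 / 4 * e2 <= d1.
  apply: le_trans h1.
  have -> : nn - 1 - 2 * (x + 1) = nn - 3 - 2 * x by ring.
  rewrite lerDl !mulr_ge0//; lra.
have le0 : 5 * nn / 6 * e0 <= d0.
  apply: le_trans h0; rewrite -[leLHS]add0r lerD//.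
    by apply: mulr_ge0 => //; apply: mulr_ge0; [exact: sqr_ge0|lra].
  by apply: ler_wpM2r => //; nra.
apply: lerD.
  apply: le_trans (ler_wpM2l _ le1); last by apply: mulr_ge0; [exact: sqr_ge0|lra].
  by rewrite le_eqVlt; apply/orP; left; apply/eqP; field.
apply: le_trans (ler_wpM2l _ le0); last by nra.
rewrite mulrA; apply: ler_wpM2r => //; nra.
Qed.

(** [rellich_poincare] leaves a quarter of [energy 1 (derive1 g)], to which the
    Hardy inequality of exponent 1 applies. *)
Lemma gradient_gap g : regular g ->
  nn ^+ 2 / 4 * E 0 (derive1 g) + nn / 16 * E 1 g + (nn - 3) ^+ 2 / 16 * E 2 g
    <= E 0 (laplacian n g).
Proof.
have nn4 := nn_ge4; move=> rg; have := rellich_poincare rg; have := hardy_power 1 rg.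
have := @energy_ge0 R n 1 g.
set e1 := E 1 g => e10 h1 h0; apply: le_trans h0.
have : nn / 4 * e1 <= nn * (nn + 1 - 2 * 1) / 6 * e1.
  by apply: ler_wpM2r => //; nra.
move: h1; have -> : (nn - 1 - 2 * 1) = nn - 3 by ring.
lra.
Qed.

Lemma laplacian_gap g : regular g ->
  (nn ^+ 2 / 4) ^+ 2 * E 0 g + (nn + 1) * nn / 16 * E 1 g
    + (nn - 3) ^+ 2 / 16 * E 2 g <= E 0 (laplacian n g).
Proof.
have nn4 := nn_ge4; move=> rg; apply: le_trans (gradient_gap rg).
have l0 : 0 <= nn ^+ 2 / 4 by apply: mulr_ge0; [exact: sqr_ge0|lra].
have := ler_wpM2l l0 (hardy_poincare rg); lra.
Qed.

End radial_inequalities.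

(** * The constants *)

Section coefficients.
Context {R : realType} (n : nat).
Local Notation nn := (n%:R : R).

Definition rellich_const i : R :=
  (nn + 1 + 2 * i%:R) ^+ 2 * (nn - 3 - 2 * i%:R) ^+ 2 / 16.

(** Coefficient of [energy (i + 2 j) g] in the lower bound for
    [energy i (Delta^t g)] obtained from [t] uses of [rellich_step]: [j] counts
    the uses that raise the exponent by 2. *)
Fixpoint iter_const i t j : R :=
  match t with
  | 0 => (j == 0%N)%:R
  | t'.+1 => (nn / 4) ^+ 2 * iter_const i t' j
             + (if j is j'.+1 then rellich_const i * iter_const i.+2 t' j' else 0)
  end.

Lemma rellich_const_ge0 i : 0 <= rellich_const i.
Proof. by rewrite divr_ge0// mulr_ge0 ?sqr_ge0. Qed.

Lemma rellich_const_gt0 i : (2 * i + 4 <= n)%N -> 0 < rellich_const i.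
Proof.
rewrite -(ler_nat R) natrD natrM => hi; have i0 : 0 <= i%:R :> R by [].
by rewrite /rellich_const divr_gt0// mulr_gt0// exprn_gt0//; lra.
Qed.

Lemma iter_const_ge0 i t j : 0 <= iter_const i t j.
Proof.
elim: t i j => [|t ih] i j /=; first exact: ler0n.
apply: addr_ge0; first by apply: mulr_ge0; [exact: sqr_ge0|exact: ih].
by case: j => // j; apply: mulr_ge0; [exact: rellich_const_ge0|exact: ih].
Qed.

Lemma iter_const_gt0 i t j : (0 < n)%N -> (2 * i + 4 * t <= n)%N -> (j <= t)%N ->
  0 < iter_const i t j.
Proof.
move=> n0; elim: t i j => [|t ih] i j /= hi jt.
  by move: jt; rewrite leqn0 => /eqP->; rewrite eqxx ltr01.
case: j jt => [|j] jt.
  rewrite addr0 mulr_gt0 ?exprn_gt0 ?divr_gt0 ?ltr0n// ih//.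
  by apply: leq_trans hi; rewrite leq_add2l leq_mul2l leqnSn orbT.
apply: ltr_wpDl; first by apply: mulr_ge0; [exact: sqr_ge0|exact: iter_const_ge0].
apply: mulr_gt0; first by apply: rellich_const_gt0; lia.
by apply: ih => //; lia.
Qed.

Lemma iter_const_eq0 i t j : (t < j)%N -> iter_const i t j = 0.
Proof.
elim: t i j => [|t ih] i [|j]//= tj.
by rewrite !ih ?mulr0 ?addr0// ltnW.
Qed.

Lemma iter_const_first i t : iter_const i t 0 = Xi_last n.+1 1 t.
Proof.
rewrite /Xi_last; have -> : n.+1%:R - 1 = nn by rewrite -natr1 addrK.
elim: t => [|t ih]/=; first by rewrite muln0 expr0.
by rewrite addr0 ih mulnS exprD.
Qed.

Lemma iter_const_last i t : iter_const i t t = Xi_first n.+1 (2 * i%:R) t.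
Proof.
rewrite /Xi_first; elim: t i => [|t ih] i /=; first by rewrite big_nil.
rewrite iter_const_eq0// mulr0 add0r ih big_nat_recl//; congr (_ * _).
  by rewrite /rellich_const -[n.+1%:R]natr1; field.
apply: eq_bigr => j _; rewrite -[n.+1%:R]natr1 -[i.+2%:R]natr1.
rewrite -[i.+1%:R]natr1 -[j.+1%:R]natr1.
by field.
Qed.

(** Coefficient of [energy k g] in the bound for
    [p * energy 1 (Delta^t g) + s * energy 2 (Delta^t g)]: the chain started at
    exponent 1 only meets the odd exponents and the one started at 2 the even
    ones, so every exponent is met exactly once. *)
Definition stage_const p s t k : R :=
  if odd k then p * iter_const 1 t k./2 else s * iter_const 2 t k./2.-1.

Lemma stage_const_ge0 p s t k : 0 <= p -> 0 <= s -> 0 <= stage_const p s t k.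
Proof.
move=> p0 s0; rewrite /stage_const.
by case: ifP => _; rewrite mulr_ge0 ?iter_const_ge0.
Qed.

Lemma stage_const_gt0 p s t k : 0 < p -> 0 < s -> (4 + 4 * t <= n)%N ->
  (1 <= k <= 2 * t + 2)%N -> 0 < stage_const p s t k.
Proof.
move=> p0 s0 tn kt; have n0 : (0 < n)%N by lia.
rewrite /stage_const; case: ifPn => ok; rewrite mulr_gt0// iter_const_gt0//; lia.
Qed.

(** The sum of the contributions of the [p + 1] gaps of [gap_telescope]; this is
    the constant [C_k] of the theorem for [m = h + p + 1]. *)
Definition gap_const h p k : R :=
  (nn ^+ 2 / 4) ^+ (2 * p) * stage_const (nn / 16) ((nn - 3) ^+ 2 / 16) h k
  + \sum_(1 <= j < p.+1) (nn ^+ 2 / 4) ^+ (2 * (p - j)) *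
      stage_const ((nn + 1) * nn / 16) ((nn - 3) ^+ 2 / 16) (h + j) k.

Lemma gap_const_ge0 h p k : (4 <= n)%N -> 0 <= gap_const h p k.
Proof.
move=> n4; have nn4 : 4 <= nn by rewrite (ler_nat _ 4).
have l0 j : 0 <= (nn ^+ 2 / 4) ^+ j by rewrite exprn_ge0// divr_ge0// sqr_ge0.
have s0 : 0 <= (nn - 3) ^+ 2 / 16 by rewrite divr_ge0// sqr_ge0.
apply: addr_ge0.
  by apply: mulr_ge0 => //; apply: stage_const_ge0 => //; lra.
by apply: sumr_ge0 => j _; apply: mulr_ge0 => //; exact: stage_const_ge0.
Qed.

(** The gap of [Delta^(h + p)] alone reaches every exponent in the range. *)
Lemma gap_const_gt0 h p k : (4 + 4 * (h + p) <= n)%N ->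
  (1 <= k <= 2 * (h + p) + 2)%N -> 0 < gap_const h p k.
Proof.
move=> hn hk; have nn4 : 4 <= nn by rewrite (ler_nat _ 4); lia.
have p0 : 0 < nn / 16 by lra.
have q0 : 0 < (nn + 1) * nn / 16 by rewrite divr_gt0// mulr_gt0//; lra.
have s0 : 0 < (nn - 3) ^+ 2 / 16 by rewrite divr_gt0// exprn_gt0//; lra.
have l0 j : 0 <= (nn ^+ 2 / 4) ^+ j by rewrite exprn_ge0// divr_ge0// sqr_ge0.
rewrite /gap_const; case: p hn hk => [|p] hn hk.
  rewrite muln0 expr0 mul1r big_geq// addr0; apply: stage_const_gt0 => //; lia.
have g0 t : 0 <= stage_const (nn / 16) ((nn - 3) ^+ 2 / 16) t k.
  by apply: stage_const_ge0; exact: ltW.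
have g1 t : 0 <= stage_const ((nn + 1) * nn / 16) ((nn - 3) ^+ 2 / 16) t k.
  by apply: stage_const_ge0; exact: ltW.
apply: ltr_wpDl; first exact: mulr_ge0.
rewrite big_nat_recr//= subnn muln0 expr0 mul1r; apply: ltr_wpDl.
  by apply: sumr_ge0 => j _; exact: mulr_ge0.
by apply: stage_const_gt0 => //; lia.
Qed.

Lemma gap_const_first h p : gap_const h p 1 =
  (if (p != 0)%N then
     nn ^+ (4 * p + 1) / 2 ^+ (4 * p + 4) * Xi_last n.+1 2 h
     + C_first n.+1 (2 * p) * Xi_last n.+1 2 h.+1
   else nn / 16 * Xi_last n.+1 2 h).
Proof.
rewrite /gap_const /stage_const /= iter_const_first.
have XE x t : Xi_last n.+1 x t = (nn / 4) ^+ (2 * t).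
  by rewrite /Xi_last; congr (_ ^+ _); rewrite -[n.+1%:R]natr1 addrK.
case: eqVneq => [->|p0] /=.
  by rewrite muln0 expr0 mul1r big_geq// addr0 !XE.
have four : 4 = 2 ^+ 2 :> R by rewrite -(natrX R 2 2).
have sixteen : 16 = 2 ^+ 4 :> R by rewrite -(natrX R 2 4).
have lamE j : (nn ^+ 2 / 4) ^+ j = nn ^+ (2 * j) / 2 ^+ (2 * j).
  by rewrite four expr_div_n -!exprM.
have nE j : (nn / 4) ^+ j = nn ^+ j / 2 ^+ (2 * j).
  by rewrite four expr_div_n -exprM.
have p2 j : 2 ^+ j != 0 :> R by rewrite expf_neq0.
congr (_ + _).
  rewrite !XE lamE (_ : 4 * p + 1 = 2 * (2 * p) + 1)%N; last by lia.
  rewrite (_ : 4 * p + 4 = 2 * (2 * p) + 4)%N; last by lia.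
  rewrite !exprD expr1 -sixteen.
  by field.
rewrite XE /C_first (_ : odd (2 * p) = false); last by lia.
rewrite (_ : (2 * p)./2 = p); last by lia.
rewrite mulr_sumr mulr_suml; apply: eq_big_nat => j jp.
rewrite iter_const_first XE lamE !nE -[n.+1%:R]natr1 addrK.
have H1 : nn ^+ (2 * (2 * (p - j))) * nn ^+ (2 * (h + j)) =
    nn ^+ (4 * p - 2 * j - 2) * nn ^+ (2 * h.+1).
  by rewrite -!exprD; congr (_ ^+ _); lia.
have H2 : 2 ^+ (2 * (2 * (p - j))) * 2 ^+ (2 * (2 * (h + j))) * 16 =
    2 ^+ (4 * p) * 2 ^+ (2 * (2 * h.+1)) :> R.
  by rewrite sixteen -!exprD; congr (_ ^+ _); lia.
set d1 := 2 ^+ _ in H2 *; set d2 := 2 ^+ _ in H2 *.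
set e1 := 2 ^+ _ in H2 *; set e2 := 2 ^+ _ in H2 *.
set a1 := nn ^+ _ in H1 *; set a2 := nn ^+ _ in H1 *.
set b1 := nn ^+ _ in H1 *; set b2 := nn ^+ _ in H1 *.
transitivity ((nn + 1) * nn * (a1 * a2) / (d1 * d2 * 16)).
  by field; rewrite !p2.
by rewrite H1 H2; field; rewrite !p2.
Qed.

(** Only the gap of [Delta^(h + p)] reaches the top exponent. The first [p - 1]
    factors of its product of Rellich constants, together with
    [(n - 3)^2 / 16], are [C_last]. *)
Lemma gap_const_last h p : gap_const h p (2 * (h + p) + 2) =
  (if (p != 0)%N then
     C_last n.+1 (2 * p) * Xi_first n.+1 (2 * (2 * p)%N%:R) h.+1
   else (nn - 3) ^+ 2 / 16 * Xi_first n.+1 4 h).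
Proof.
rewrite /gap_const /stage_const.
rewrite (_ : odd (2 * (h + p) + 2) = false); last by lia.
rewrite (_ : (2 * (h + p) + 2)./2.-1 = (h + p)%N); last by lia.
case: p => [|p] /=.
  rewrite muln0 expr0 mul1r big_geq// addr0 addn0 iter_const_last.
  by rewrite -natrM.
rewrite iter_const_eq0; last by lia.
rewrite !mulr0 add0r big_nat_recr//= subnn muln0 expr0 mul1r big_nat_cond.
rewrite big1 => [|j jp]; last by rewrite iter_const_eq0 ?mulr0//; lia.
rewrite add0r iter_const_last /C_last (_ : odd (2 * p.+1) = false); last by lia.
rewrite (_ : (2 * p.+1)./2 = p.+1); last by lia.
have -> : n.+1%:R - 4 = nn - 3 by rewrite -[n.+1%:R]natr1; ring.
rewrite /Xi_first (@big_cat_nat _ _ _ p)//=; last by lia.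
rewrite big_add1 /=.
pose F i : R := (n.+1%:R + 2 * 2 + 4 * i%:R) ^+ 2 *
  (n.+1%:R - 2 * 2 - 4 * i%:R - 4) ^+ 2 / 16.
have -> : \prod_(p <= i < h + p.+1) F i = \prod_(0 <= i < h.+1) F (i + p)%N.
  by rewrite -{1}[p]add0n big_addn (_ : h + p.+1 - p = h.+1)%N//; lia.
have -> : \prod_(0 <= j < h.+1) ((n.+1%:R + 2 * (2 * p.+1)%:R + 4 * j%:R) ^+ 2 *
    (n.+1%:R - 2 * (2 * p.+1)%:R - 4 * j%:R - 4) ^+ 2 / 16) =
    \prod_(0 <= j < h.+1) F (j + p)%N.
  apply: eq_bigr => j _; rewrite /F natrD natrM -[p.+1%:R]natr1.
  by congr (_ ^+ 2 * _ ^+ 2 / _); ring.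
rewrite mulrA; congr (_ * _).
rewrite big_split/= prodr_const_nat subn0.
set head := \prod_(0 <= i < p) _.
have -> : head = \prod_(0 <= i < p)
    ((n.+1%:R + 4 * i.+1%:R) ^+ 2 * (n.+1%:R - 4 * i.+1%:R - 4) ^+ 2).
  apply: eq_bigr => j _; rewrite -[j.+1%:R]natr1.
  by congr (_ ^+ 2 * _ ^+ 2); ring.
have -> : ((nn - 3) / 2 ^+ (2 * p.+1)) ^+ 2 = (nn - 3) ^+ 2 / 16 * 16^-1 ^+ p.
  rewrite expr_div_n -exprM (_ : 2 * p.+1 * 2 = 4 * p.+1)%N; last by lia.
  have -> : 2 ^+ (4 * p.+1) = 16 ^+ p.+1 :> R by rewrite exprM -(natrX R 2 4).
  have : 16 ^+ p != 0 :> R by rewrite expf_neq0.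
  by rewrite exprVn (exprS 16 p); move: (16 ^+ p) => q q0; field.
by rewrite -[RHS]mulrA [X in _ = _ * X]mulrC.
Qed.

End coefficients.

(** * The inequality on one ray *)

Section chain.
Context {R : realType} (n : nat) (a b : R).
Hypotheses (a0 : 0 < a) (ab : a <= b).
Local Notation nn := (n%:R : R).
Local Notation E := (energy n).
Variable G : nat -> R -> R.
Hypotheses (rG : forall j, regular a b (G j))
  (GS : forall j, G j.+1 = laplacian n (G j)).

Lemma iter_const_le i t K : (4 <= n)%N -> (2 * i + 4 * t <= n)%N ->
  \sum_(0 <= j < K) iter_const n i t j * E (i + 2 * j) (G 0) <= E i (G t).
Proof.
move=> n4; elim: t i K => [|t ih] i K hi.
  case: K => [|K]; first by rewrite big_geq// energy_ge0.
  rewrite big_nat_recl// big1 => [|j _]; last by rewrite mul0r.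
  by rewrite /= mul1r addr0 muln0 addn0.
rewrite GS; apply: le_trans (rellich_step a0 ab n4 (rG t) _); last by lia.
have hi1 : (2 * i + 4 * t <= n)%N by lia.
have hi2 : (2 * i.+2 + 4 * t <= n)%N by lia.
under eq_bigr do rewrite /= mulrDl -mulrA.
rewrite big_split/= -mulr_sumr addrC; apply: lerD; last first.
  by apply: ler_wpM2l; [exact: sqr_ge0|exact: ih].
case: K => [|K].
  by rewrite big_geq// mulr_ge0 ?energy_ge0 ?rellich_const_ge0.
rewrite big_nat_recl// mul0r add0r.
under eq_bigr => j _.
  rewrite -mulrA (_ : (i + 2 * j.+1)%N = (i.+2 + 2 * j)%N); last by lia.
  over.
rewrite -mulr_sumr; apply: ler_wpM2l; [exact: rellich_const_ge0|exact: ih].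
Qed.

Lemma stage_const_le p s t K : 0 <= p -> 0 <= s -> (4 + 4 * t <= n)%N ->
  \sum_(1 <= k < (2 * K).+1) stage_const n p s t k * E k (G 0)
    <= p * E 1 (G t) + s * E 2 (G t).
Proof.
move=> p0 s0 tn.
have -> : \sum_(1 <= k < (2 * K).+1) stage_const n p s t k * E k (G 0) =
    \sum_(0 <= j < K) (p * (iter_const n 1 t j * E (1 + 2 * j) (G 0))
      + s * (iter_const n 2 t j * E (2 + 2 * j) (G 0))).
  elim: K => [|K ih]; first by rewrite !big_geq.
  rewrite mulnS big_nat_recr// big_nat_recr//= ih [in RHS]big_nat_recr//= -addrA.
  congr (_ + _); rewrite /stage_const.
  rewrite (_ : odd (2 * K).+1 = true); last by lia.
  rewrite (_ : odd (2 * K).+2 = false); last by lia.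
  rewrite (_ : ((2 * K).+1)./2 = K); last by lia.
  rewrite (_ : ((2 * K).+2)./2.-1 = K); last by lia.
  by rewrite !mulrA.
rewrite big_split/= -!mulr_sumr.
by apply: lerD; apply: ler_wpM2l => //; apply: iter_const_le; lia.
Qed.

(** Induction on [p]: the Laplacian gap of [G (h + p + 1)] pays for replacing
    [energy 0 (G (h + p + 2))] by [lambda^2 energy 0 (G (h + p + 1))]. *)
Lemma gap_telescope h p : (4 <= n)%N ->
  (nn ^+ 2 / 4) ^+ (2 * p) *
     (nn / 16 * E 1 (G h) + (nn - 3) ^+ 2 / 16 * E 2 (G h))
  + \sum_(1 <= j < p.+1) (nn ^+ 2 / 4) ^+ (2 * (p - j)) *
      ((nn + 1) * nn / 16 * E 1 (G (h + j)) + (nn - 3) ^+ 2 / 16 * E 2 (G (h + j)))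
  <= E 0 (G (h + p).+1) - (nn ^+ 2 / 4) ^+ (2 * p + 1) * E 0 (derive1 (G h)).
Proof.
move=> n4; set lam := nn ^+ 2 / 4.
have l0 : 0 <= lam by apply: mulr_ge0; [exact: sqr_ge0|lra].
elim: p => [|p ih].
  rewrite muln0 big_geq// expr0 mul1r addr0 addn0 add0n expr1 GS.
  by have := gradient_gap a0 ab n4 (rG h); rewrite -/lam; lra.
have := laplacian_gap a0 ab n4 (rG (h + p.+1)); rewrite -GS -/lam.
have := ler_wpM2l (sqr_ge0 lam) ih.
rewrite [\sum_(1 <= j < p.+2) _]big_nat_recr//= subnn muln0 expr0 mul1r.
rewrite mulrDr mulr_sumr.
have -> : \sum_(1 <= j < p.+1) lam ^+ 2 * (lam ^+ (2 * (p - j)) *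
   ((nn + 1) * nn / 16 * E 1 (G (h + j)) + (nn - 3) ^+ 2 / 16 * E 2 (G (h + j)))) =
   \sum_(1 <= j < p.+1) lam ^+ (2 * (p.+1 - j)) *
   ((nn + 1) * nn / 16 * E 1 (G (h + j)) + (nn - 3) ^+ 2 / 16 * E 2 (G (h + j))).
  apply: eq_big_nat => j jp; rewrite mulrA -exprD; congr (_ ^+ _ * _); lia.
rewrite (addnS h p).
rewrite (_ : (2 * p.+1 + 1 = 2 + (2 * p + 1))%N); last by lia.
rewrite (_ : (2 * p.+1 = 2 + 2 * p)%N); last by lia.
rewrite (exprD lam 2 (2 * p + 1)) (exprD lam 2 (2 * p)).
set S := \sum_(1 <= j < p.+1) _; set P := _ + (nn - 3) ^+ 2 / 16 * E 2 (G h).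
set Y := lam ^+ (2 * p + 1); set X := lam ^+ (2 * p).
set D := E 0 (derive1 (G h)); set e := E 0 (G (h + p).+1).
set e2 := E 0 (G (h + p).+2).
set c1 := _ * E 1 _; set c2 := _ * E 2 _.
move: S P Y X D e e2 c1 c2 (lam ^+ 2) => S P Y X D e e2 c1 c2 L.
lra.
Qed.

Lemma radial_gap h p : (4 + 4 * (h + p) <= n)%N ->
  \sum_(1 <= k < (2 * (h + p).+1).+1) gap_const n h p k * E k (G 0)
  + (nn ^+ 2 / 4) ^+ (2 * p + 1) * E 0 (derive1 (G h)) <= E 0 (G (h + p).+1).
Proof.
move=> hn; have n4 : (4 <= n)%N by lia.
have nn4 : 4 <= nn by rewrite (ler_nat _ 4); lia.
have p0 : 0 <= nn / 16 by lra.
have q0 : 0 <= (nn + 1) * nn / 16 by rewrite divr_ge0// mulr_ge0//; lra.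
have s0 : 0 <= (nn - 3) ^+ 2 / 16 by rewrite divr_ge0// exprn_ge0//; lra.
have l0 j : 0 <= (nn ^+ 2 / 4) ^+ j by rewrite exprn_ge0// divr_ge0// sqr_ge0.
rewrite -lerBrDr; apply: le_trans (gap_telescope h p n4).
under eq_bigr do rewrite mulrDl -mulrA mulr_suml.
rewrite big_split/= -mulr_sumr; apply: lerD.
  by apply: ler_wpM2l => //; apply: stage_const_le => //; lia.
rewrite exchange_big_nat/=; apply: ler_sum_nat => j jp.
under eq_bigr do rewrite -mulrA.
rewrite -mulr_sumr; apply: ler_wpM2l => //; apply: stage_const_le => //; lia.
Qed.

End chain.

(** * Superadditivity of the integral *)

Section lower_integral.
Context d {T : measurableType d} {R : realType} (mu : {measure set T -> \bar R}).
Implicit Types (D : set T) (f g : T -> R).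
Import HBNNSimple.

Lemma ereal_supD_le (A B : set \bar R) (z : \bar R) :
  (forall x, A x -> 0 <= x)%E -> (forall y, B y -> 0 <= y)%E -> A 0%E -> B 0%E ->
  (forall x y, A x -> B y -> x + y <= z)%E -> (ereal_sup A + ereal_sup B <= z)%E.
Proof.
move=> Age0 Bge0 A0 B0 AB.
have z0 : (0 <= z)%E by have := AB _ _ A0 B0; rewrite adde0.
have [->|zfin] := eqVneq z +oo%E; first exact: leey.
have {}zfin : z \is a fin_num by rewrite ge0_fin_numE// ltey.
have Afin x : A x -> x \is a fin_num.
  move=> Ax; rewrite ge0_fin_numE ?Age0//; apply: (@le_lt_trans _ _ z).
    by have := AB _ _ Ax B0; rewrite adde0.
  by rewrite -ge0_fin_numE.
have supBle x : A x -> (ereal_sup B <= z - x)%E.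
  by move=> Ax; apply: ge_ereal_sup => y By; rewrite leeBrDl ?Afin// AB.
have supB0 : (0 <= ereal_sup B)%E by exact: ereal_sup_ubound.
have supBfin : ereal_sup B \is a fin_num.
  rewrite ge0_fin_numE//; apply: (@le_lt_trans _ _ z).
    by have := supBle _ A0; rewrite sube0.
  by rewrite -ge0_fin_numE.
rewrite -leeBrDr//; apply: ge_ereal_sup => x Ax.
by rewrite leeBrDr// -leeBrDl ?Afin// supBle.
Qed.

Let simple_below D f := [set h : {nnsfun T >-> R} |
  forall x, ((h x)%:E <= ((EFin \o f) \_ D) x)%E].

Let integral_sup D f : (forall x, D x -> 0 <= f x) ->
  (\int[mu]_(x in D) (f x)%:E = ereal_sup (sintegral mu @` simple_below D f))%E.
Proof. by move=> f0; rewrite ge0_integralE// => x Dx; rewrite lee_fin f0. Qed.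

Let simple_below0 D f : (forall x, D x -> 0 <= f x) ->
  (sintegral mu @` simple_below D f) 0%E.
Proof.
move=> f0; exists nnsfun0; last exact: sintegral0.
move=> x /=; rewrite patchE; case: ifPn => // /set_mem Dx.
by rewrite lee_fin f0.
Qed.

(** The integral of an arbitrary nonnegative function is the supremum of the
    integrals of the simple functions below it, and simple functions below the
    two summands add up to one below the sum. *)
Lemma le_integralD D f g k : (forall x, D x -> 0 <= f x) ->
  (forall x, D x -> 0 <= g x) -> (forall x, D x -> f x + g x <= k x) ->
  (\int[mu]_(x in D) (f x)%:E + \int[mu]_(x in D) (g x)%:E
     <= \int[mu]_(x in D) (k x)%:E)%E.
Proof.
move=> f0 g0 fgk; have k0 x : D x -> 0 <= k x.
  by move=> Dx; apply: le_trans (fgk x Dx); rewrite addr_ge0 ?f0 ?g0.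
rewrite !integral_sup//; apply: ereal_supD_le; try exact: simple_below0.
- by move=> _ [h _ <-]; exact: sintegral_ge0.
- by move=> _ [h _ <-]; exact: sintegral_ge0.
move=> _ _ [p pf <-] [q qg <-]; apply: ereal_sup_ubound.
exists (add_nnsfun p q); last exact: sintegralD.
move=> x /=; rewrite EFinD; have := pf x; have := qg x; rewrite !patchE.
case: ifPn => /= [/set_mem Dx qx px|_ qx px].
  by apply: le_trans (leeD px qx) _; rewrite -EFinD lee_fin fgk.
by apply: le_trans (leeD px qx) _; rewrite adde0.
Qed.

Lemma le_integral_nonneg D f k : (forall x, D x -> 0 <= f x) ->
  (forall x, D x -> f x <= k x) ->
  (\int[mu]_(x in D) (f x)%:E <= \int[mu]_(x in D) (k x)%:E)%E.
Proof.
move=> f0 fk; have := @le_integralD D f (cst 0) k f0 (fun _ _ => lexx _).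
rewrite integral0 adde0; apply=> x Dx; rewrite addr0; exact: fk.
Qed.

Lemma le_integralZ D (c : R) f : 0 <= c -> (forall x, D x -> 0 <= f x) ->
  (c%:E * \int[mu]_(x in D) (f x)%:E <= \int[mu]_(x in D) (c * f x)%:E)%E.
Proof.
rewrite le_eqVlt => /predU1P[<-|c0] f0.
  by rewrite mul0e; apply: integral_ge0 => x _; rewrite mul0r.
have cf0 x : D x -> 0 <= c * f x by move=> Dx; rewrite mulr_ge0 ?f0 ?(ltW c0).
rewrite -lee_pdivlMl// (integral_sup f0) (integral_sup cf0).
apply: ge_ereal_sup => _ [h hf <-]; rewrite lee_pdivlMl//.
apply: ereal_sup_ubound; exists (scale_nnsfun h (ltW c0)); last exact: sintegralrM.
move=> x /=; rewrite EFinM; have := hf x; rewrite !patchE.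
have c0E : (0 <= c%:E)%E by rewrite lee_fin ltW.
case: ifPn => /= [_ hx|_ hx]; first by rewrite EFinM; exact: lee_wpmul2l.
by have := lee_wpmul2l c0E hx; rewrite mule0.
Qed.

Lemma le_integral_sum D (I : Type) (s : seq I) (c : I -> R) (f : I -> T -> R) k :
  (forall i, 0 <= c i) -> (forall i x, D x -> 0 <= f i x) ->
  (forall x, D x -> \sum_(i <- s) c i * f i x <= k x) ->
  (\sum_(i <- s) (c i)%:E * \int[mu]_(x in D) (f i x)%:E
     <= \int[mu]_(x in D) (k x)%:E)%E.
Proof.
move=> c0 f0; elim: s k => [|i s ih] k kge.
  rewrite big_nil; apply: integral_ge0 => x Dx.
  by rewrite lee_fin; have := kge x Dx; rewrite big_nil.
rewrite big_cons.
have cf0 x : D x -> 0 <= c i * f i x by move=> Dx; rewrite mulr_ge0 ?f0.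
have sum0 x : D x -> 0 <= \sum_(j <- s) c j * f j x.
  by move=> Dx; apply: sumr_ge0 => j _; rewrite mulr_ge0 ?f0.
apply: le_trans (@le_integralD D _ _ k cf0 sum0 _).
  apply: leeD; first exact: (le_integralZ (c0 i) (f0 i)).
  by apply: ih => x _; exact: lexx.
by move=> x Dx; have := kge x Dx; rewrite big_cons.
Qed.

End lower_integral.

(** * The surface measure of the sphere *)

Section sigma_finite_alias.
Context d {T : measurableType d} {R : realType} (mu : {measure set T -> \bar R}).

(** A name for [mu] that carries the proof, so that the product with a measure
    known to be sigma-finite only through a hypothesis can be formed. *)
Definition with_sigma_finite (_ : sigma_finite setT mu) : set T -> \bar R := mu.

Variable sf : sigma_finite setT mu.

HB.instance Definition _ := Measure.copy (with_sigma_finite sf) mu.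

HB.instance Definition _ :=
  Measure_isSigmaFinite.Build _ _ _ (with_sigma_finite sf) sf.

End sigma_finite_alias.

Section lebesgue_tuple_measure.
Context {R : realType}.
Local Notation mR := (measurableTypeR R).

Definition cube n (k : nat) : set (n.-tuple mR) :=
  [set x | forall i, `|tnth x i : R| <= k%:R].

Arguments cube : clear implicits.

Lemma measurable_cube n k : measurable (cube n k).
Proof.
have -> : cube n k = \bigcap_(i in [set: 'I_n])
    ((fun x : n.-tuple mR => tnth x i) @^-1` `[- (k%:R : R), k%:R]%classic).
  apply/seteqP; split=> [x xk i _|x xk i] /=.
    by rewrite in_itv/= -ler_norml; exact: xk.
  by have := xk i I; rewrite /= in_itv/= -ler_norml.
apply: fin_bigcap_measurable => [|i _]; first exact: finite_finset.
rewrite -[X in measurable X]setTI.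
by apply: measurable_tnth => //; exact: measurable_itv.
Qed.

Lemma cube_cover n : \bigcup_k cube n k = setT.
Proof.
apply/seteqP; split=> // x _.
exists (Num.bound (\sum_i `|tnth x i : R|)) => //= i.
apply: le_trans (ltW (archi_boundP _)); last exact: sumr_ge0.
by rewrite (bigD1 i)//= lerDl sumr_ge0.
Qed.

(* The measure structure carried by [pushforward]. *)
Local Notation image_measure :=
  measure_function_pushforward__canonical__measure_function_Measure.

(** That [lebesgue_tuple n.+1] is a measure depends on [lebesgue_tuple n] being
    sigma-finite, so the induction carries the finiteness on cubes, which
    exhaust the space. *)
Lemma lebesgue_tuple_measure n :
  exists2 mu : {measure set (n.-tuple mR) -> \bar R},
    mu = @lebesgue_tuple R n :> (set _ -> \bar R) &
    forall k, (mu (cube n k) < +oo)%E.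
Proof.
elim: n => [|n [mu muE mu_cube]].
  exists (\d_ ([tuple] : 0.-tuple mR)) => // k.
  by rewrite /= diracE ltry.
have sf : sigma_finite setT mu.
  exists (cube n) => [|k]; first by rewrite cube_cover.
  by split; [exact: measurable_cube|exact: mu_cube].
pose sm : {sigma_finite_measure set (n.-tuple mR) -> \bar R} :=
  with_sigma_finite sf.
have mcons : measurable_fun setT
    (fun p : mR * n.-tuple mR => [tuple of p.1 :: p.2]).
  by apply: measurable_cons; [exact: measurable_fst|exact: measurable_snd].
exists (image_measure (@lebesgue_measure R \x sm)%E mcons) => [|k].
  by rewrite /= -muE.
pose I : set mR := `[- (k%:R : R), k%:R]%classic.
have Ifin : (@lebesgue_measure R I < +oo)%E.
  by rewrite lebesgue_measure_itv/=; case: ifPn => // _; rewrite -EFinD ltry.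
rewrite /= /pushforward [X in (_ X < _)%E](_ : _ = I `*` cube n k).
  rewrite product_measure1E; [|exact: measurable_itv|exact: measurable_cube].
  apply: lte_mul_pinfty => //; last exact: mu_cube.
  by rewrite ge0_fin_numE.
apply/seteqP; split=> -[x t] /= => [xt|[xI tk] i].
  split; last by move=> i; have := xt (lift ord0 i); rewrite tnthS.
  by have := xt ord0; rewrite tnth0 /I/= in_itv/= -ler_norml.
have [j ->|->] := unliftP ord0 i; first by rewrite tnthS; exact: tk.
by rewrite tnth0 ler_norml; move: xI; rewrite /I/= in_itv.
Qed.

Lemma euclidean_norm_ge0 n (x : n.-tuple mR) : 0 <= euclidean_norm x.
Proof. exact: sqrtr_ge0. Qed.

Lemma measurable_euclidean_norm n :
  measurable_fun setT (@euclidean_norm R n : n.-tuple mR -> mR).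
Proof.
have sum0 (x : n.-tuple mR) : 0 <= \sum_(i < n) (tnth x i : R) ^+ 2.
  by apply: sumr_ge0 => i _; exact: sqr_ge0.
rewrite (_ : @euclidean_norm R n =
    (fun y : R => y `^ 2^-1) \o (fun x => \sum_(i < n) (tnth x i : R) ^+ 2)).
  apply: measurableT_comp; first exact: measurable_powR.
  apply: measurable_sum => i; apply: measurable_funX; exact: measurable_tnth.
by apply/funext => x /=; rewrite powR12_sqrt.
Qed.

Lemma measurable_normalize n : measurable_fun setT (@normalize R n).
Proof.
apply/measurable_fun_tnthP => i.
rewrite (_ : _ \o _ = (fun x : n.-tuple mR =>
    (euclidean_norm x `^ (- 1)) * (tnth x i : R))).
  apply: measurable_funM; last exact: measurable_tnth.
  apply: (measurableT_comp (measurable_powR _)).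
  exact: measurable_euclidean_norm.
apply/funext => x /=; rewrite tnth_map powR_inv1//; exact: euclidean_norm_ge0.
Qed.

Definition punctured_ball n : set (n.-tuple mR) :=
  [set x | (0 < euclidean_norm x <= 1)%R].
Arguments punctured_ball : clear implicits.

Lemma measurable_punctured_ball n : measurable (punctured_ball n).
Proof.
have -> : punctured_ball n = @euclidean_norm R n @^-1` `]0, 1]%classic.
  by apply/seteqP; split=> x /=; rewrite in_itv.
rewrite -[X in measurable X]setTI.
by apply: measurable_euclidean_norm => //; exact: measurable_itv.
Qed.

Lemma punctured_ball_cube n : punctured_ball n `<=` cube n 1.
Proof.
move=> x /andP[_ x1] i.
rewrite mulr1n -(@ler_pXn2r _ 2) ?nnegrE ?ler01 ?normr_ge0 //.
rewrite expr1n real_normK ?num_real//.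
apply: (@le_trans _ _ (euclidean_norm x ^+ 2)); last by rewrite expr_le1// sqrtr_ge0.
rewrite sqr_sqrtr; last by apply: sumr_ge0 => j _; exact: sqr_ge0.
by rewrite (bigD1 i)//= lerDl sumr_ge0// => j _; exact: sqr_ge0.
Qed.

Lemma sphere_measure_finite_measure n :
  exists2 mu : {measure set (n.-tuple mR) -> \bar R},
    mu = @sphere_measure R n :> (set _ -> \bar R) & (mu setT < +oo)%E.
Proof.
have [leb lebE leb_cube] := lebesgue_tuple_measure n.
pose nu := mrestr leb (@measurable_punctured_ball n).
exists (mscale (n%:R)%:nng (image_measure nu (@measurable_normalize n))).
  apply/funext => A; rewrite /sphere_measure -lebE /mscale/= /pushforward /nu /mrestr.
  by congr (_ * leb _)%E; apply/seteqP; split=> x [].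
have ball_fin : (leb (punctured_ball n) < +oo)%E.
  apply: le_lt_trans (leb_cube 1%N); apply: le_measure; rewrite ?inE.
  - exact: measurable_punctured_ball.
  - exact: measurable_cube.
  - exact: punctured_ball_cube.
rewrite [X in (X < _)%E](_ : _ = n%:R%:E * leb (punctured_ball n))%E.
  exact: lte_mul_pinfty.
by congr (_ * leb _)%E; apply/seteqP; split=> x // [].
Qed.

End lebesgue_tuple_measure.

(** * Radial test functions *)

Section uniformly_smooth.
Context {R : realType} (N : nat) (a b : R).
Hypothesis a0 : 0 < a.
Local Notation mR := (measurableTypeR R).
Implicit Types (F G : @polar_fun R N) (r : R) (s : N.-tuple mR).

(** The bounds are uniform in the direction: they make integrals over the sphere
    finite. The recursion goes through [radial_derive], so that stability under
    products and under [coth] follows from the formulas for one derivative. *)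
Fixpoint uniformly_smooth k F : Prop :=
  [/\ exists M, forall r s, a <= r <= b -> sphere s -> `|F r s| <= M,
      forall r s, 0 < r -> sphere s -> derivable (F^~ s) r 1 &
      match k with
      | 0 => True
      | k'.+1 => uniformly_smooth k' (radial_derive F)
      end].

Lemma near_pos_eq_derive F G s r : 0 < r -> (forall r, 0 < r -> F r s = G r s) ->
  (derivable (F^~ s) r 1 -> derivable (G^~ s) r 1) /\
  radial_derive F r s = radial_derive G r s.
Proof.
move=> r0 FG; have nFG : \forall x \near r, F x s = G x s.
  by near=> x; apply: FG; near: x; exact: lt_nbhsr.
split; first exact: near_eq_derivable.
by rewrite /radial_derive !derive1E; exact: near_eq_derive.
Unshelve. all: by end_near. Qed.

Lemma eq_uniformly_smooth k F G :
  (forall r s, 0 < r -> sphere s -> F r s = G r s) ->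
  uniformly_smooth k F -> uniformly_smooth k G.
Proof.
have bnd F' G' : (forall r s, 0 < r -> sphere s -> F' r s = G' r s) ->
    (exists M, forall r s, a <= r <= b -> sphere s -> `|F' r s| <= M) ->
    exists M, forall r s, a <= r <= b -> sphere s -> `|G' r s| <= M.
  move=> FG' [M FM]; exists M => r s /andP[ar rb] ss.
  by rewrite -FG' ?FM ?ar//; exact: lt_le_trans ar.
have dif F' G' : (forall r s, 0 < r -> sphere s -> F' r s = G' r s) ->
    (forall r s, 0 < r -> sphere s -> derivable (F'^~ s) r 1) ->
    forall r s, 0 < r -> sphere s -> derivable (G'^~ s) r 1.
  move=> FG' dF r s r0 ss; apply: (near_pos_eq_derive r0 _).1 (dF r s r0 ss).
  by move=> x x0; exact: FG'.
elim: k F G => [|k ih] F G FG [bF dF sF].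
  by split; [exact: bnd bF|exact: dif dF|].
split; [exact: bnd bF|exact: dif dF|].
apply: ih sF => r s r0 ss; apply: (near_pos_eq_derive r0 _).2 => x x0.
exact: FG.
Qed.

Lemma uniformly_smoothW k F : uniformly_smooth k.+1 F -> uniformly_smooth k F.
Proof.
elim: k F => [|k ih] F [bF dF sF]; split; [exact: bF|exact: dF|by []|
  exact: bF|exact: dF|exact: ih].
Qed.

Lemma uniformly_smoothD k F G : uniformly_smooth k F -> uniformly_smooth k G ->
  uniformly_smooth k (fun r s => F r s + G r s).
Proof.
have bnd F' G' (M M' : R) :
    (forall r s, a <= r <= b -> sphere s -> `|F' r s| <= M) ->
    (forall r s, a <= r <= b -> sphere s -> `|G' r s| <= M') ->
    exists M, forall r s, a <= r <= b -> sphere s -> `|F' r s + G' r s| <= M.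
  move=> FM GM; exists (M + M') => r s rab ss; apply: le_trans (ler_normD _ _) _.
  by rewrite lerD ?FM ?GM.
elim: k F G => [|k ih] F G [[M FM] dF sF] [[M' GM] dG sG]; split.
- exact: bnd FM GM.
- by move=> r s r0 ss; exact: (derivableD (dF r s r0 ss) (dG r s r0 ss)).
- by [].
- exact: bnd FM GM.
- by move=> r s r0 ss; exact: (derivableD (dF r s r0 ss) (dG r s r0 ss)).
apply: eq_uniformly_smooth (ih _ _ sF sG) => r s r0 ss.
by rewrite /radial_derive (is_derive_derive1 (has_deriv_add
  (derivable_is_derive (dF r s r0 ss)) (derivable_is_derive (dG r s r0 ss)))).
Qed.

Lemma uniformly_smoothM k F G : uniformly_smooth k F -> uniformly_smooth k G ->
  uniformly_smooth k (fun r s => F r s * G r s).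
Proof.
have bnd F' G' (M M' : R) :
    (forall r s, a <= r <= b -> sphere s -> `|F' r s| <= M) ->
    (forall r s, a <= r <= b -> sphere s -> `|G' r s| <= M') ->
    exists M, forall r s, a <= r <= b -> sphere s -> `|F' r s * G' r s| <= M.
  move=> FM GM; exists (M * M') => r s rab ss; rewrite normrM.
  by rewrite ler_pM ?FM ?GM.
elim: k F G => [|k ih] F G sF0 sG0;
  have [[M FM] dF sF] := sF0; have [[M' GM] dG sG] := sG0; split.
- exact: bnd FM GM.
- by move=> r s r0 ss; exact: (derivableM (dF r s r0 ss) (dG r s r0 ss)).
- by [].
- exact: bnd FM GM.
- by move=> r s r0 ss; exact: (derivableM (dF r s r0 ss) (dG r s r0 ss)).
apply: eq_uniformly_smooth (uniformly_smoothD
  (ih _ _ sF (uniformly_smoothW sG0)) (ih _ _ (uniformly_smoothW sF0) sG)).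
move=> r s r0 ss; rewrite /radial_derive (is_derive_derive1 (has_deriv_mul
  (derivable_is_derive (dF r s r0 ss)) (derivable_is_derive (dG r s r0 ss)))).
by [].
Qed.

Lemma uniformly_smooth_cst k (c : N.-tuple mR -> R) (M : R) :
  (forall s, sphere s -> `|c s| <= M) -> uniformly_smooth k (fun r s => c s).
Proof.
elim: k c M => [|k ih] c M cM; split=> //.
- by exists M => r s _; exact: cM.
- by exists M => r s _; exact: cM.
have sF0 : uniformly_smooth k (fun _ _ => 0).
  by apply: (ih _ 0) => s _; rewrite normr0.
apply: eq_uniformly_smooth sF0 => r s _ _.
by rewrite /radial_derive derive1_cst.
Qed.

(** Induction through the differential equation [coth' = 1 - coth^2]. *)
Lemma uniformly_smooth_coth k : uniformly_smooth k (fun r _ => coth r).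
Proof.
have bc : exists M, forall r s, a <= r <= b -> @sphere R N s -> `|coth r| <= M.
  exists (a^-1 + b / 3) => r s /andP[ar rb] _; have r0 := lt_le_trans a0 ar.
  have ri0 : 0 < r^-1 by rewrite invr_gt0.
  rewrite ger0_norm; last exact: le_trans (ltW ri0) (coth_ge r0).
  have : coth r <= r^-1 + r / 3.
    rewrite -(ler_pM2r ri0); apply: le_trans (coth_le r0) _.
    by rewrite mulrDl -expr2 lerD2l mulrAC divff ?mul1r// gt_eqF.
  have : r^-1 <= a^-1 by rewrite lef_pV2 ?posrE.
  lra.
have dc r s : 0 < r -> @sphere R N s -> derivable (@coth R) r 1.
  by move=> r0 _; exact: is_derive_derivable (has_deriv_coth r0).
elim: k => [|k ih]; split=> //.
have c1 : uniformly_smooth k (fun _ _ => 1).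
  by apply: (@uniformly_smooth_cst _ _ 1) => s; rewrite normr1.
have cN1 : uniformly_smooth k (fun _ _ => -1).
  by apply: (@uniformly_smooth_cst _ _ 1) => s; rewrite normrN1.
apply: eq_uniformly_smooth (uniformly_smoothD c1 (uniformly_smoothM cN1
  (uniformly_smoothM ih ih))) => r s r0 _.
by rewrite /radial_derive (is_derive_derive1 (has_deriv_coth r0)) mulN1r expr2.
Qed.

Definition radial_test F := (forall k, uniformly_smooth k F) /\
  (forall s, sphere s -> supported a b (F^~ s)).

Lemma radial_test_derive F : radial_test F -> radial_test (radial_derive F).
Proof.
move=> [sF supF]; split=> [k|s ss]; first by have [] := sF k.+1.
exact/supported_derive/supF.
Qed.

Lemma radial_test_laplacian F : radial_test F -> radial_test (radial_laplacian F).
Proof.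
move=> tF; have [sF' supF'] := radial_test_derive tF.
have [sF'' supF''] := radial_test_derive (radial_test_derive tF).
split=> [k|s ss r r0 rab]; last first.
  rewrite /radial_laplacian (supF'' s ss r r0 rab).
  by rewrite (supF' s ss r r0 rab) mulr0 addr0.
apply: uniformly_smoothD => //; apply: uniformly_smoothM => //.
apply: uniformly_smoothM; last exact: uniformly_smooth_coth.
exact: (@uniformly_smooth_cst _ _ `|N%:R - 1|).
Qed.

Lemma radial_test_regular F s : radial_test F -> sphere s -> regular a b (F^~ s).
Proof.
move=> [sF supF] ss; have [_ d0 [_ d1 [_ d2 _]]] := sF 2%N.
by split=> [r r0|r r0|r r0|]; [exact: d0|exact: d1|exact: d2|exact: supF].
Qed.

End uniformly_smooth.

(** * Smooth functions in polar coordinates *)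

Section test_functions.
Context {R : realType} (N : nat).
Local Notation mR := (measurableTypeR R).
Implicit Types (f u : 'rV[R]_N -> R) (r : R) (s : N.-tuple mR) (x v : 'rV[R]_N).

Definition row_of s : 'rV[R]_N := \row_i (tnth s i : R).

Definition sqr_norm x : R := \sum_i x 0 i ^+ 2.

Lemma sqr_norm_continuous : continuous sqr_norm.
Proof.
rewrite /sqr_norm; elim: (index_enum _) => [|i l ih].
  by under eq_fun do rewrite big_nil; move=> x; exact: cst_continuous.
pose p x : R := x 0 i.
have cp : continuous p by exact: coord_continuous.
have cpp : continuous (fun x => p x * p x).
  by move=> x; exact: (@continuousM _ _ p p x (cp x) (cp x)).
under eq_fun do rewrite big_cons expr2.
move=> x; exact: (@continuousD _ _ _ (fun x => p x * p x) _ x (cpp x) (ih x)).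
Qed.

Lemma sphere_sum s : sphere s -> \sum_i (tnth s i : R) ^+ 2 = 1.
Proof.
move=> ss; rewrite -[LHS]sqr_sqrtr; last by apply: sumr_ge0 => i _; exact: sqr_ge0.
by rewrite [Num.sqrt _]ss expr1n.
Qed.

Lemma sqr_norm_ray r s : sphere s -> sqr_norm (r *: row_of s) = r ^+ 2.
Proof.
move=> /sphere_sum s1; rewrite /sqr_norm; under eq_bigr do rewrite !mxE exprMn.
by rewrite -mulr_sumr s1 mulr1.
Qed.

Lemma sphere_coord_le1 s i : sphere s -> `|tnth s i : R| <= 1.
Proof.
move=> /sphere_sum s1; rewrite -(@ler_pXn2r _ 2) ?nnegrE ?ler01 ?normr_ge0//.
rewrite expr1n real_normK ?num_real// -s1 (bigD1 i)//= lerDl.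
by apply: sumr_ge0 => j _; exact: sqr_ge0.
Qed.

Lemma polar_difference f r s h :
  polar f (h + r) s = f (h *: row_of s + r *: row_of s).
Proof. by rewrite /polar scalerDl. Qed.

Lemma radial_derive_polar f r s : differentiable f (r *: row_of s) ->
  derivable ((polar f)^~ s) r 1 /\
  radial_derive (polar f) r s =
    \sum_i tnth s i * polar ('D_('e_i) f) r s.
Proof.
move=> df.
have E : (fun h : R => h^-1 *: (((polar f)^~ s \o shift r) (h *: 1) - polar f r s))
    = (fun h : R => h^-1 *: ((f \o shift (r *: row_of s)) (h *: row_of s)
        - f (r *: row_of s))).
  apply/funext => h /=; rewrite [_%:A]mulr1 -polar_difference.
  by rewrite /polar.
split.
  by rewrite /derivable E; exact: diff_derivable.
rewrite /radial_derive derive1E.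
transitivity ('D_(row_of s) f (r *: row_of s)); first by rewrite /derive E.
rewrite deriveE// [X in 'd f _ X]row_sum_delta linear_sum.
by apply: eq_bigr => i _; rewrite linearZ/= mxE /polar deriveE.
Qed.

Lemma polar_bounded (a b : R) f : continuous f ->
  exists M, forall r s, 0 < a -> a <= r <= b -> sphere s -> `|polar f r s| <= M.
Proof.
move=> cf; pose K := [set x : 'rV[R]_N | forall i, `[- b, b]%classic (x ord0 i)].
have [b0|b0] := ltP 0 b; last first.
  exists 0 => r s a0 /andP[ar rb]; exfalso; move: a0 ar rb b0; lra.
have cK : compact K.
  by apply: (@rV_compact _ _ (fun=> `[- b, b]%classic)) => i; exact: segment_compact.
have K0 : K !=set0.
  by exists 0 => i /=; rewrite mxE in_itv/= oppr_le0 (ltW b0).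
have cf' : {within K, continuous (fun x => `|f x|)}.
  apply: continuous_subspaceT => x.
  exact: (continuous_comp (cf x) (@norm_continuous _ _ (f x))).
have [c _ fc] := EVT_max_rV K0 cK cf'.
exists `|f c| => r s a0 /andP[ar rb] ss; apply: fc.
rewrite inE => i /=; rewrite !mxE in_itv/= -ler_norml normrM.
have r0 : 0 < r by exact: lt_le_trans ar.
rewrite (gtr0_norm r0) -[b]mulr1.
by apply: ler_pM => //; [exact: ltW|exact: sphere_coord_le1].
Qed.

(** The radial derivative of [f] is the sum over [i] of the [i]-th coordinate of
    [s] times the partial derivative of [f], read in polar coordinates. Hence the
    bounds on derivatives, uniform in [s], reduce to the boundedness of the
    partial derivatives of [f] on a compact box. *)
Lemma uniformly_smooth_polar (a b : R) k f : 0 < a -> Ck k.+1 f ->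
  uniformly_smooth a b k (polar f).
Proof.
move=> a0; elim: k f => [|k ih] f [df Df].
  split=> //; last by move=> r s _ _; exact: (radial_derive_polar (df _)).1.
  have [M fM] := @polar_bounded a b f (fun x => differentiable_continuous (df x)).
  by exists M => r s; exact: fM.
split.
- have [M fM] := @polar_bounded a b f (fun x => differentiable_continuous (df x)).
  by exists M => r s; exact: fM.
- by move=> r s _ _; exact: (radial_derive_polar (df _)).1.
have sterm i : uniformly_smooth a b k
    (fun r s => (tnth s i : R) * polar ('D_('e_i) f) r s).
  have sc : uniformly_smooth a b k (fun _ s => tnth s i : R).
    by apply: (@uniformly_smooth_cst R N a b a0 k (fun s => tnth s i : R) 1) => s;
       exact: sphere_coord_le1.
  exact: (uniformly_smoothM a0 sc (ih _ (Df _))).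
have ssum (l : seq 'I_N) : uniformly_smooth a b k
    (fun r s => \sum_(i <- l) (tnth s i : R) * polar ('D_('e_i) f) r s).
  elim: l => [|i l ihl].
    have s0 := @uniformly_smooth_cst R N a b a0 k (fun _ => 0) 0.
    apply: eq_uniformly_smooth (s0 _) => [//|r s _ _|s _]; first by rewrite big_nil.
    by rewrite normr0.
  apply: eq_uniformly_smooth (uniformly_smoothD a0 (sterm i) ihl) => // r s _ _.
  by rewrite big_cons.
apply: eq_uniformly_smooth (ssum _) => // r s _ _.
by rewrite (radial_derive_polar (df _)).2.
Qed.

(** On the ray in direction [s] the continuous function [sqr_norm] is [r^2], so
    its extrema on the support of [u] enclose the radii of the support. *)
Lemma test_function_radial u : test_function u ->
  exists a b, [/\ 0 < a, a <= b & radial_test a b (polar u)].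
Proof.
move=> [su cK K0]; set K := tsupport u in cK K0.
have uK x : ~ K x -> u x = 0.
  move=> Kx; apply/eqP; apply: contra_notT Kx => ux; exact: subset_closure.
suff [a [b [a0 ab rK]]] : exists a b : R, [/\ 0 < a, a <= b &
    forall r s, 0 < r -> sphere s -> r < a \/ b < r -> ~ K (r *: row_of s)].
  exists a, b; split=> //; split=> [k|s ss r r0 rab].
    by apply: uniformly_smooth_polar => //; exact: su.
  exact/uK/rK.
have [KE|/set0P Kn0] := eqVneq K set0.
  exists 1, 1; split; [exact: ltr01|exact: lexx|].
  by move=> r s _ _ _; rewrite KE.
have cQ : {within K, continuous sqr_norm}.
  by apply: continuous_subspaceT; exact: sqr_norm_continuous.
have [c cK' Qc] := EVT_min_rV Kn0 cK cQ.
have [d dK' Qd] := EVT_max_rV Kn0 cK cQ.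
have Q0 x : 0 <= sqr_norm x by apply: sumr_ge0 => i _; exact: sqr_ge0.
have Qc0 : 0 < sqr_norm c.
  rewrite lt_neqAle Q0 andbT eq_sym; apply: contra_notN K0 => /eqP Qc0.
  suff -> : 0 = c by exact: set_mem cK'.
  apply/rowP => i; rewrite mxE; apply/esym/eqP; rewrite -sqrf_eq0.
  move/eqP: Qc0; rewrite psumr_eq0 => [/allP/(_ i (mem_index_enum i))//|j _].
  exact: sqr_ge0.
(* These bounds avoid square roots: [r^2 <= r] for [r <= 1], and [r <= r^2] for
   [1 <= r]. *)
exists (Num.min 1 (sqr_norm c)), (1 + sqr_norm d); split.
- by rewrite lt_min ltr01.
- by rewrite ge_min lerDl Q0.
move=> r s r0 ss rab /mem_set Krs.
have := Qc _ Krs; have := Qd _ Krs; rewrite sqr_norm_ray// => rd rc.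
case: rab => [|dr].
  rewrite lt_min => /andP[r1 rc']; have : r ^+ 2 < sqr_norm c.
    by apply: le_lt_trans rc'; rewrite expr2 ger_pMl// ltW.
  by rewrite ltNge rc.
have := Q0 d; nra.
Qed.

End test_functions.

(** * Integration over the sphere and conclusion *)

Section sphere_integrals.
Context {R : realType} (n : nat) (a b : R).
Hypotheses (a0 : 0 < a) (ab : a <= b).
Local Notation N := n.+1.
Local Notation mR := (measurableTypeR R).
Implicit Types (F : @polar_fun R N) (s : N.-tuple mR).

Lemma hyperbolic_integral_energy (mu : {measure set (N.-tuple mR) -> \bar R}) i F :
  mu = @sphere_measure R N :> (set _ -> \bar R) -> radial_test a b F ->
  hyperbolic_integral (fun r s => F r s ^+ 2 / r ^+ (2 * i)) =
  (\int[mu]_(s in @sphere R N) (energy n i (F^~ s))%:E)%E.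
Proof.
move=> muE tF; rewrite /hyperbolic_integral -muE.
apply: eq_integral => s /set_mem ss.
have [d0 _ _ sF] := radial_test_regular tF ss.
exact: (half_line_integralE a0 (compact_continuous_energy n i d0 sF)).
Qed.

Lemma energy_bounded i F : radial_test a b F ->
  exists K, forall s, sphere s -> energy n i (F^~ s) <= K.
Proof.
move=> tF; have [[M FM] _ _] := tF.1 0%N.
pose w r : R := sinh r ^+ n / r ^+ (2 * i).
have ab' : a / 2 <= b + 1 by have := a0; have := ab; lra.
have a20 : 0 < a / 2 by rewrite divr_gt0.
have cw : {within `[a / 2, b + 1], continuous w}.
  apply: continuous_in_subspaceT => x; rewrite inE/= in_itv/= => /andP[ax _].
  by apply: (@pos_continuous_weight R n i); exact: lt_le_trans ax.
have [c _ wc] := EVT_max ab' cw.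
pose K := M ^+ 2 * `|w c|.
exists (K * (b + 1 - a / 2)) => s ss.
have [d0 _ _ sF] := radial_test_regular tF ss.
have cE := compact_continuous_energy n i d0 sF.
rewrite -lee_fin -(half_line_integralE a0 cE).
rewrite (integral_half_line_supported a0 ab cE.2).
have -> : ((K * (b + 1 - a / 2))%:E =
   \int[lebesgue_measure]_(r in `[(a / 2)%R, (b + 1)%R]) K%:E)%E.
  rewrite integral_cst//= lebesgue_measure_itv/= lte_fin.
  rewrite ifT ?EFinM ?EFinB//; have := a0; have := ab; lra.
apply: le_integral_nonneg => r; rewrite /= in_itv/= => /andP[ar rb].
  have r0 : 0 < r by exact: lt_le_trans ar.
  by rewrite mulr_ge0 ?divr_ge0 ?sqr_ge0 ?exprn_ge0 ?sinh_ge0 ?ltW.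
have r0 : 0 < r by exact: lt_le_trans ar.
have K0 : 0 <= K by rewrite mulr_ge0 ?sqr_ge0.
have [rab|] := boolP (a <= r <= b); last first.
  rewrite negb_and -!ltNge => /orP rab; rewrite (sF r r0 rab).
  by rewrite expr0n mul0r mul0r.
have -> : F r s ^+ 2 / r ^+ (2 * i) * sinh r ^+ n = F r s ^+ 2 * w r.
  by rewrite /w; ring.
have w0 : 0 <= w r by rewrite divr_ge0 ?exprn_ge0 ?sinh_ge0 ?ltW.
have wle : w r <= `|w c|.
  by apply: le_trans (ler_norm _); apply: wc; rewrite in_itv/= ar rb.
apply: ler_pM => //; first exact: sqr_ge0.
rewrite -real_normK ?num_real// lerXn2r ?nnegrE ?FM//.
by rewrite (le_trans _ (FM r s rab ss)).
Qed.

Lemma hyperbolic_energy_finite i F : radial_test a b F ->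
  (hyperbolic_integral (fun r s => (F r s ^+ 2 / r ^+ (2 * i))%R) < +oo)%E.
Proof.
move=> tF; have [mu muE mufin] := @sphere_measure_finite_measure R N.
rewrite (hyperbolic_integral_energy i muE tF).
have [K EK] := energy_bounded i tF.
rewrite integral_mkcond.
have -> : (fun s => (energy n i (F^~ s))%:E) \_ (@sphere R N) =
    (fun s => (((fun s => energy n i (F^~ s)) \_ (@sphere R N)) s)%:E).
  by apply/funext => s; rewrite !patchE; case: ifP.
apply: (@le_lt_trans _ _ (\int[mu]_(s in setT) (`|K|)%:E)%E).
  apply: le_integral_nonneg => s _; rewrite patchE; case: ifPn => // ss.
  - exact: energy_ge0.
  - by apply: le_trans (EK s _) (ler_norm _); exact: set_mem.
  - exact: normr_ge0.
by rewrite integral_cst//; apply: lte_mul_pinfty; rewrite ?lee_fin.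
Qed.

End sphere_integrals.

Lemma radial_laplacian_slice {R : realType} n (F : @polar_fun R n.+1) s :
  (radial_laplacian F)^~ s = laplacian n (F^~ s).
Proof.
apply/funext => r; rewrite /radial_laplacian /laplacian.
by rewrite -[n.+1%:R]natr1 addrK.
Qed.

Theorem theorem4p4 (R : realType) (N k l m h : nat)
  (hk : k = (2 * m)%N) (hl : l = (2 * h + 1)%N)
  (hlk : (l < k)%N) (hN : (2 * k < N)%N) :
  exists C : nat -> R,
    [/\ forall i : nat, (1 <= i <= k)%N -> 0 < C i,
        C 1%N =
          (if (m - h != 1)%N then
             (N%:R - 1) ^+ (2 * k - 2 * l - 1) / 2 ^+ (2 * k - 2 * l + 2)
               * Xi_last N 2 ((l - 1) %/ 2)
             + C_first N (k - l - 1) * Xi_last N 2 ((l + 1) %/ 2)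
           else
             (N%:R - 1) / 16 * Xi_last N 2 ((l - 1) %/ 2)),
        C k =
          (if (m - h != 1)%N then
             C_last N (k - l - 1)
               * Xi_first N (2 * (k - l - 1)%N%:R) ((l + 1) %/ 2)
           else
             (N%:R - 4) ^+ 2 / 16 * Xi_first N 4 ((l - 1) %/ 2))
      & forall u : 'rV[R]_N -> R, test_function u ->
          let U := polar u in
          let Lm := iter m (@radial_laplacian R N) U in
          let Lh := iter h (@radial_laplacian R N) U in
          (\sum_(1 <= i < k.+1)
             (C i)%:E *
             hyperbolic_integral (fun r s => (U r s ^+ 2 / r ^+ (2 * i))%R)
           <= hyperbolic_integral (fun r s => (Lm r s ^+ 2)%R)
              - (((N%:R - 1) / 2) ^+ (4 * (m - h) - 2))%:E *
                hyperbolic_integral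
                  (fun r s => (radial_derive Lh r s ^+ 2)%R))%E ].
Proof.
(* [p] is the number of Laplacian gaps, and [p = 0] is the case [m - h = 1]. *)
have [p mE] : exists p, m = (h + p).+1 by exists (m - h - 1)%N; lia.
case: N hN => [|n] hN; first by lia.
have hn : (4 + 4 * (h + p) <= n)%N by lia.
have n4 : (4 <= n)%N by lia.
have n1E : n.+1%:R - 1 = n%:R :> R by rewrite -[n.+1%:R]natr1 addrK.
have n4E : n.+1%:R - 4 = n%:R - 3 :> R by rewrite -[n.+1%:R]natr1; ring.
have -> : ((l - 1) %/ 2)%N = h by lia.
have -> : ((l + 1) %/ 2)%N = h.+1 by lia.
have -> : (k - l - 1)%N = (2 * p)%N by lia.
have -> : (2 * k - 2 * l - 1 = 4 * p + 1)%N by lia.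
have -> : (2 * k - 2 * l + 2 = 4 * p + 4)%N by lia.
have -> : (4 * (m - h) - 2 = 2 * (2 * p + 1))%N by lia.
have -> : (m - h != 1)%N = (p != 0)%N by lia.
have kE : k = (2 * (h + p) + 2)%N by lia.
rewrite n1E n4E; exists (gap_const n h p); split.
- by move=> i ik; apply: gap_const_gt0 => //; lia.
- exact: gap_const_first.
- by rewrite kE gap_const_last.
move=> u tu; cbv zeta; set U := polar u.
set Lm := iter m _ U; set Lh := iter h _ U.
have [a [b [a0 ab tU]]] := test_function_radial tu.
have tL j : radial_test a b (iter j (@radial_laplacian R n.+1) U).
  by elim: j => // j ih; exact: radial_test_laplacian.
have tdL := radial_test_derive (tL h).
have sqE (F : @polar_fun R n.+1) :
    (fun r s => F r s ^+ 2) = (fun r s => F r s ^+ 2 / r ^+ (2 * 0)).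
  by apply/funext => r; apply/funext => s; rewrite muln0 expr0 divr1.
rewrite (sqE Lm) (sqE (radial_derive Lh)).
have [mu muE _] := @sphere_measure_finite_measure R n.+1.
have c0 : 0 <= (n%:R / 2) ^+ (2 * (2 * p + 1)) :> R.
  by rewrite exprn_ge0// divr_ge0.
have dfin := hyperbolic_energy_finite a0 ab 0 tdL.
rewrite leeBrDr; last first.
  rewrite fin_numM// ge0_fin_numE//.
  rewrite (hyperbolic_integral_energy a0 0 muE tdL).
  by apply: integral_ge0 => s _; rewrite lee_fin energy_ge0.
rewrite (hyperbolic_integral_energy a0 0 muE tdL).
rewrite (hyperbolic_integral_energy a0 0 muE (tL m)).
under eq_bigr do rewrite (hyperbolic_integral_energy a0 _ muE tU).
have e0 i (F : @polar_fun R n.+1) s : 0 <= energy n i (F^~ s) by exact: energy_ge0.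
have C0 i : 0 <= gap_const n h p i :> R by exact: gap_const_ge0.
pose A s := \sum_(1 <= i < k.+1) gap_const n h p i * energy n i (U^~ s).
pose B s := (n%:R / 2) ^+ (2 * (2 * p + 1)) * energy n 0 ((radial_derive Lh)^~ s).
(* [A] and [B] are the two terms on the smaller side of [radial_gap]. *)
apply: (@le_trans _ _ (\int[mu]_(s in @sphere R n.+1) (A s)%:E +
  \int[mu]_(s in @sphere R n.+1) (B s)%:E)%E).
  apply: leeD; last by apply: le_integralZ => // s _; exact: e0.
  apply: (@le_integral_sum _ _ R mu _ _ _ (gap_const n h p)
    (fun i s => energy n i (U^~ s)) A C0) => [i s _|s _]; [exact: e0|exact: lexx].
apply: le_integralD => [s _|s _|s ss].
- by apply: sumr_ge0 => i _; rewrite mulr_ge0.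
- by rewrite mulr_ge0// e0.
pose G j := (iter j (@radial_laplacian R n.+1) U)^~ s.
have rG j : regular a b (G j) by exact: radial_test_regular (tL j) ss.
have GS j : G j.+1 = laplacian n (G j) by exact: radial_laplacian_slice.
have := radial_gap a0 ab rG GS hn.
rewrite (_ : (2 * (h + p).+1).+1 = k.+1); last by lia.
rewrite -mE (_ : n%:R ^+ 2 / 4 = (n%:R / 2) ^+ 2); last by field.
by rewrite -exprM.
Qed.
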